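(* Let $f\in L^\infty(\mathbb{R})$. Write $p_n(x)=x^n$. Let $g$ be an absolutely continuous function on $\mathbb{R}$ such that (a) $g'\in L^1(\mathbb{R})$, (b) $g'$ is of bounded variation, (c) $p_2g\in L^1(\mathbb{R})$. Let $h\in L^1(\mathbb{R})\cap C^1(\mathbb{R})$ be such that $h$ and $h'$ are of bounded variation and $h'$ is absolutely continuous. Then $$\int_{-\infty}^\infty\widehat{f\ast g}\;h=\int_{-\infty}^\infty\hat f\,\hat g\,h,$$ where the left side is the distributional integral of $\widehat{f\ast g}$ (with $f\ast g\in L^\infty(\mathbb{R})$) against $h$ and the right side is the distributional integral of $\hat f$ against the function $\hat g h$.
   Context: Functions are complex-valued; for $g\in L^1(\mathbb{R})$, $\hat g(s)=\int_{-\infty}^\infty e^{-ist}g(t)\,dt$; $f\ast g(x)=\int_{-\infty}^\infty f(s)g(x-s)\,ds$. For $F\in L^\infty(\mathbb{R})$ put $\hat F_1(s)=\int_{-1}^1e^{-ist}F(t)\,dt$ and $\Psi_F(s)=\int_{|t|>1}e^{-ist}F(t)\,\frac{dt}{t^2}$ (continuous, vanishing at $\pm\infty$). The Fourier transform of $F$ is the tempered distribution $\hat F=\hat F_1+\hat F_2$ with $\hat F_2=-\Psi_F''$ (second distributional derivative). The derivative of an absolutely continuous function is said to be of bounded variation if it agrees almost everywhere with a right continuous function of bounded variation. Distributional integral: for absolutely continuous $u\in L^1(\mathbb{R})$ whose derivative is (a.e.) a right continuous function $v$ of bounded variation, $\int_{-\infty}^\infty\hat F u$ is defined as $\int_{-\infty}^\infty\hat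 F_1(s)u(s)\,ds-\int_{-\infty}^\infty\Psi_F(t)\,dv(t)$, the last integral being a Stieltjes integral. *)

(* Defs.v *)
From HB Require Import structures.
From mathcomp Require Import all_boot all_order all_algebra.
From mathcomp Require Export complex.
From mathcomp Require Import all_classical all_reals all_analysis.
From mathcomp Require Import lra.

Set Implicit Arguments.
Unset Strict Implicit.
Unset Printing Implicit Defensive.

Import Order.TTheory GRing.Theory Num.Theory.
Import numFieldNormedType.Exports.

Local Open Scope classical_set_scope.
Local Open Scope ring_scope.
Local Open Scope complex_scope.

Section defs.
Context {R : realType}.
Local Notation mu := (@lebesgue_measure R).
Local Notation Re := (@complex.Re R).
Local Notation Im := (@complex.Im R).
Local Notation normc := (@Normc.normc R).
Implicit Types (f g h u v F G : R -> R[i]) (a b s t x y : R).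

(* The library integrates real- and extended-real-valued functions only, and
   puts no structure of normed R-module on R[i]; integrals, derivatives and
   one-point continuity of complex-valued functions are taken on real and
   imaginary parts. The modulus is [normc : R[i] -> R]. *)

Definition cmeasurable f :=
  measurable_fun [set: R] (fun x => Re (f x)) /\
  measurable_fun [set: R] (fun x => Im (f x)).

Definition L1 f :=
  mu.-integrable [set: R] (fun x => (Re (f x))%:E) /\
  mu.-integrable [set: R] (fun x => (Im (f x))%:E).

Definition Linfty f :=
  cmeasurable f /\
  exists M : R, {ae mu, forall x, normc (f x) <= M}.

Definition cintegral (D : set R) f : R[i] :=
  (\int[mu]_(x in D) Re (f x)) +i* (\int[mu]_(x in D) Im (f x)).

Definition is_cderive f x (d : R[i]) :=
  is_derive x 1 (fun y => Re (f y)) (Re d) /\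
  is_derive x 1 (fun y => Im (f y)) (Im d).

(* Total function; its values are relevant only where [f] is differentiable. *)
Definition cderive f x : R[i] :=
  derive1 (fun y => Re (f y)) x +i* derive1 (fun y => Im (f y)) x.

Definition ccontinuous f :=
  continuous (fun x => Re (f x)) /\ continuous (fun x => Im (f x)).

Definition C1 f :=
  (forall x, is_cderive f x (cderive f x)) /\ ccontinuous (cderive f).

Definition cright_continuous f :=
  forall x, Re (f y) @[y --> x^'+] --> Re (f x) /\
            Im (f y) @[y --> x^'+] --> Im (f x).

(* Absolute continuity on every compact interval. *)
Definition abs_continuous f :=
  forall a b, a <= b -> forall eps : R, 0 < eps ->
  exists2 delta : R, 0 < delta &
    forall (n : nat) (x y : nat -> R),
      (forall i, (i < n)%N -> a <= x i <= y i /\ y i <= b) ->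
      trivIset `I_n (fun i => `]x i, y i[%classic) ->
      \sum_(0 <= i < n) (y i - x i) < delta ->
      \sum_(0 <= i < n) normc (f (y i) - f (x i)) < eps.

(* The points of the partition [a :: s] of [[a, b]] are [node a b s i],
   for [i <= size s]; see [itv_partition]. *)
Definition node a b (s : seq R) (i : nat) : R := nth b (a :: s) i.

Definition bv f :=
  exists M : R, forall a b (s : seq R), itv_partition a b s ->
    \sum_(0 <= i < size s)
      normc (f (node a b s i.+1) - f (node a b s i)) <= M.

(* [v] is the right continuous function of bounded variation which agrees
   almost everywhere with the derivative of [u]. *)
Definition bv_derivative u v :=
  [/\ cright_continuous v, bv v & {ae mu, forall x, is_cderive u x (v x)}].

(* Riemann-Stieltjes integral of [F] with respect to [v] over [[a, b]]. *)
Definition is_stieltjes_itv F v a b (I : R[i]) :=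
  forall eps : R, 0 < eps ->
  exists2 delta : R, 0 < delta &
    forall (s : seq R) (xi : nat -> R), itv_partition a b s ->
      (forall i, (i < size s)%N ->
         node a b s i.+1 - node a b s i < delta /\
         node a b s i <= xi i <= node a b s i.+1) ->
      normc
        (\sum_(0 <= i < size s)
           F (xi i) * (v (node a b s i.+1) - v (node a b s i)) - I) < eps.

(* Limit of the integrals over [[a, b]] as [a --> -oo] and [b --> +oo]. *)
Definition is_stieltjes F v (I : R[i]) :=
  forall eps : R, 0 < eps ->
  exists2 A : R, 0 < A & forall a b, a <= - A -> A <= b ->
    exists2 J, is_stieltjes_itv F v a b J &
               normc (J - I) < eps.

(* e ^ (- i theta) *)
Definition expNi (theta : R) : R[i] := cos theta -i* sin theta.

Definition fourier g s : R[i] :=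
  cintegral [set: R] (fun t => expNi (s * t) * g t).

Definition convolution f g x : R[i] :=
  cintegral [set: R] (fun s => f s * g (x - s)).

Definition fourier1 F s : R[i] :=
  cintegral `[(-1), 1]%classic (fun t => expNi (s * t) * F t).

Definition Psi F s : R[i] :=
  cintegral [set t | 1 < `|t|] (fun t => expNi (s * t) * F t * (t ^- 2)%:C).

(* [I] is the distributional integral of the Fourier transform of [F] against
   [u]; this includes that [F] and [u] are admissible. *)
Definition is_dist_integral F u (I : R[i]) :=
  [/\ Linfty F, abs_continuous u, L1 u &
      exists v J, [/\ bv_derivative u v, is_stieltjes (Psi F) v J &
        I = cintegral [set: R] (fun s => fourier1 F s * u s) - J]].

Definition dist_integrable F u := exists I, is_dist_integral F u I.

(* Meaningful when [dist_integrable F u]; see [dist_integralP]. *)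
Definition dist_integral F u : R[i] := xget 0 (is_dist_integral F u).

(* Well-definedness of [dist_integral]. *)

Lemma normc_small (z : R[i]) : (forall e : R, 0 < e -> normc z < e) -> z = 0.
Proof.
move=> ze; apply: Normc.eq0_normc; apply/eqP.
have z0 : 0 <= normc z by case: (z) => x y /=; exact: sqrtr_ge0.
by case: ltgtP z0 => // z0 _; have := ze _ z0; rewrite ltxx.
Qed.

Lemma normc_distC (z w : R[i]) : normc (z - w) = normc (w - z).
Proof. by rewrite -normcN opprB. Qed.

Lemma normc_dist_lt (z1 z2 w : R[i]) (e : R) :
  normc (w - z1) < e / 2 -> normc (w - z2) < e / 2 -> normc (z1 - z2) < e.
Proof.
move=> h1 h2; rewrite -(subrKA w) (splitr e).
apply: le_lt_trans (le_normcD _ _) _.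
by rewrite ltrD // normc_distC.
Qed.

Lemma ex_fine_partition a b (delta : R) : a < b -> 0 < delta ->
  exists2 s : seq R, itv_partition a b s &
    forall i, (i < size s)%N ->
      node a b s i.+1 - node a b s i < delta /\ node a b s i <= node a b s i.+1.
Proof.
move=> ab d0; pose n := (Num.truncn ((b - a) / delta)).+1.
have n0 : 0 < n%:R :> R by rewrite ltr0n.
pose c := (b - a) / n%:R.
have c0 : 0 < c by rewrite divr_gt0 // subr_gt0.
have cd : c < delta.
  rewrite /c ltr_pdivrMr // mulrC -ltr_pdivrMr //; exact: truncnS_gt.
pose p i := a + i%:R * c.
have pn : p n = b.
  by rewrite /p /c mulrCA divff ?mulr1 ?gt_eqF // addrC subrK.
have p0 : p 0%N = a by rewrite /p mul0r addr0.
have pS i : p i.+1 - p i = c.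
  by rewrite /p -natr1 mulrDl mul1r addrA (addrC (a + _)) addrK.
pose s := mkseq (fun i => p i.+1) n.
have nodeE i : (i <= n)%N -> node a b s i = p i.
  by case: i => [|i] ni; rewrite /node /= ?p0 // nth_mkseq.
exists s.
  split; last first.
    rewrite /s (last_nth b) size_mkseq -/(node a b s n) nodeE //.
    exact/eqP.
  apply/(pathP b) => i; rewrite size_mkseq => ni.
  rewrite -/(node a b s i) nodeE ?(ltnW ni)//.
  by rewrite nth_mkseq// -subr_gt0 pS.
move=> i; rewrite size_mkseq => ni.
by rewrite !nodeE// ?(ltnW ni)// pS -subr_ge0 pS (ltW c0).
Qed.

Lemma is_stieltjes_itv_unique F v a b I J : a < b ->
  is_stieltjes_itv F v a b I -> is_stieltjes_itv F v a b J -> I = J.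
Proof.
move=> ab hI hJ; apply/eqP; rewrite -subr_eq0; apply/eqP.
apply: normc_small => e e0.
have e20 : 0 < e / 2 by rewrite divr_gt0.
have [d1 d10 h1] := hI _ e20; have [d2 d20 h2] := hJ _ e20.
have d0 : 0 < Num.min d1 d2 by rewrite lt_min d10.
have [s abs hs] := ex_fine_partition ab d0.
apply: normc_dist_lt (h1 s (node a b s) abs _) (h2 s (node a b s) abs _);
  by move=> i /hs[] + le; rewrite lt_min lexx le => /andP[].
Qed.

Lemma is_stieltjes_unique F v I J :
  is_stieltjes F v I -> is_stieltjes F v J -> I = J.
Proof.
move=> hI hJ; apply/eqP; rewrite -subr_eq0; apply/eqP.
apply: normc_small => e e0.
have e20 : 0 < e / 2 by rewrite divr_gt0.
have [A1 A10 h1] := hI _ e20; have [A2 A20 h2] := hJ _ e20.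
pose A := Num.max A1 A2.
have [A1A A2A] : A1 <= A /\ A2 <= A by rewrite /A !le_max !lexx orbT.
have A0 : 0 < A by exact: lt_le_trans A1A.
have [||K1 K1P K1I] := h1 (- A) A; rewrite ?lerN2//.
have [||K2 K2P K2J] := h2 (- A) A; rewrite ?lerN2//.
have AA : - A < A by rewrite (lt_trans _ A0)// oppr_lt0.
by apply: normc_dist_lt K1I _; rewrite (is_stieltjes_itv_unique AA K1P K2P).
Qed.

Lemma ae_eq_right_continuous (k l : R -> R) (x : R) :
  {ae mu, forall y, k y = l y} ->
  k y @[y --> x^'+] --> k x -> l y @[y --> x^'+] --> l x -> k x = l x.
Proof.
move=> [N [mN N0 kl]] kx lx; apply/eqP; rewrite -subr_eq0; apply/negPn/negP.
move=> kl0.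
have : \forall y \near x^'+, k y - l y != 0.
  by apply: (cvgr_neq0 (k x - l x)) => //; exact: cvgB.
rewrite near_withinE => /nbhs_ballP[e /= e0 xe].
have /(le_measure mu) : `]x, x + e[%classic `<=` N.
  move=> y /=; rewrite in_itv/= => /andP[xy yxe]; apply: kl => /= kly.
  have /xe : ball x e y by rewrite /ball/= ltr_distlC; lra.
  by move=> /(_ xy); rewrite kly subrr eqxx.
rewrite !inE => /(_ (measurable_itv _) mN).
rewrite [X in (_ <= X)%E]N0 [X in (X <= _)%E]lebesgue_measure_itv/= lte_fin.
rewrite ltrDl e0.
by rewrite -EFinB lee_fin addrAC subrr add0r leNgt e0.
Qed.

Lemma bv_derivative_unique u v w :
  bv_derivative u v -> bv_derivative u w -> v = w.
Proof.
move=> [vr _ uv] [wr _ uw].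
have FF : Filter (almost_everywhere mu) by exact: ae_filter_ringOfSetsType.
have vw : {ae mu, forall y, v y = w y}.
  apply: filterS2 uv uw => y [[_ d1] [_ d2]] [[_ d3] [_ d4]].
  apply/eqP; rewrite eq_complex -d1 -d2 d3 d4.
  by rewrite !eqxx.
apply/funext => x; apply/eqP; rewrite eq_complex; apply/andP; split; apply/eqP.
- have [vx _] := vr x; have [wx _] := wr x.
  apply: (@ae_eq_right_continuous (fun y => Re (v y)) (fun y => Re (w y))) => //.
  by apply: filterS vw => y ->.
- have [_ vx] := vr x; have [_ wx] := wr x.
  apply: (@ae_eq_right_continuous (fun y => Im (v y)) (fun y => Im (w y))) => //.
  by apply: filterS vw => y ->.
Qed.

Lemma dist_integralP F u I : is_dist_integral F u I -> dist_integral F u = I.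
Proof.
move=> hI; rewrite /dist_integral; apply: xget_unique => // J.
have [_ _ _ [v [K [uv vK ->]]]] := hI.
move=> [_ _ _ [w [L [uw wL ->]]]].
have vw := bv_derivative_unique uv uw; rewrite -vw in wL.
by rewrite (is_stieltjes_unique vK wL).
Qed.

End defs.

(* Main.v *)
Require Import Defs.
From HB Require Import structures.
From mathcomp Require Import all_boot all_order all_algebra.
From mathcomp Require Import all_classical all_reals all_analysis.
From mathcomp Require Import measurable_realfun.
From mathcomp Require Import ring lra.

(* The distributional integral satisfies Parseval's formula: the integral of
   the transform of [F] against [u] equals [\int F * fourier u]. Indeed the
   Stieltjes integral of [exp(-ist) dv(s)], [v = u'], is [- t^2 * fourier u t]
   (two integrations by parts), so that Fubini turns [- \int Psi_F dv] into
   [\int_(|t| > 1) F * fourier u], while [\int fourier1 F * u] gives the part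
   over [[-1, 1]]. Once both sides are written in this form, the theorem reads
   [\int (f * g) (fourier h) = \int f (fourier (fourier g * h))], and both
   sides equal [\iint f(t) g(y) (fourier h)(t + y)]. *)

Set Implicit Arguments.
Unset Strict Implicit.
Unset Printing Implicit Defensive.

Import Order.TTheory GRing.Theory Num.Theory.
Import numFieldNormedType.Exports.

Local Open Scope classical_set_scope.
Local Open Scope ring_scope.
Local Open Scope complex_scope.

Local Notation normc := Normc.normc.
Local Notation normcM := Normc.normcM.

(** * Complex-valued integrals *)

(** Three obstacles shape the proof. The exchange of [dt] with [dv] is made on Riemann-Stieltjes
    sums, which commute with the integral over [t]; what remains is the convergence of sums of
    exponentials. Their error grows like [t] times the mesh, and [F t / t] need not be integrable at
    infinity, so the error is also bounded by the total variation of [v] and dominated convergence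
    decides. The derivative of [fourier g s * h s] must be of bounded variation on the whole line,
    while [fourier g] and its derivative are only known to be bounded and Lipschitz. The remedy is
    an inequality for a function [k] of bounded variation having a primitive [K] of bounded
    variation: the modulus of [k x] times the smaller of [y - x] and [1] is at most twice the sum of
    the variations of [k] and [K] on [[x, y]]. It serves for [h] with its primitive and for [h']
    with [h], and it also makes [h] and [h'] vanish at infinity. Finally, [f] does not decay, so the
    last double integral converges only because [fourier h] decays like [1 / (1 + t ^+ 2)], hence is
    integrable. *)

Section modulus.
Context {R : realType}.
Local Notation Re := (@complex.Re R).
Local Notation Im := (@complex.Im R).
Implicit Types (z w : R[i]) (a b x y : R).

Lemma normc_ge0 z : 0 <= normc z.
Proof. by case: z => x y /=; exact: sqrtr_ge0. Qed.

Lemma cReD z w : Re (z + w) = Re z + Re w. Proof. by case: z; case: w. Qed.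
Lemma cImD z w : Im (z + w) = Im z + Im w. Proof. by case: z; case: w. Qed.
Lemma cReN z : Re (- z) = - Re z. Proof. by case: z. Qed.
Lemma cImN z : Im (- z) = - Im z. Proof. by case: z. Qed.
Lemma cReB z w : Re (z - w) = Re z - Re w. Proof. by rewrite cReD cReN. Qed.
Lemma cImB z w : Im (z - w) = Im z - Im w. Proof. by rewrite cImD cImN. Qed.
Lemma cReM z w : Re (z * w) = Re z * Re w - Im z * Im w.
Proof. by case: z; case: w. Qed.
Lemma cImM z w : Im (z * w) = Re z * Im w + Im z * Re w.
Proof. by case: z; case: w. Qed.

Definition cReImE := (cReD, cImD, cReN, cImN, cReM, cImM).

Lemma eq_ReIm z w : Re z = Re w -> Im z = Im w -> z = w.
Proof. by case: z => a b; case: w => c d /= -> ->. Qed.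

Lemma le_Re_normc z : `|Re z| <= normc z.
Proof. by case: z => x y /=; rewrite -sqrtr_sqr ler_wsqrtr// lerDl sqr_ge0. Qed.

Lemma le_Im_normc z : `|Im z| <= normc z.
Proof. by case: z => x y /=; rewrite -sqrtr_sqr ler_wsqrtr// lerDr sqr_ge0. Qed.

Lemma normc_real x : normc x%:C = `|x|.
Proof. by rewrite /= expr0n/= addr0 sqrtr_sqr. Qed.

Lemma normc_i x : normc (0 +i* x) = `|x|.
Proof. by rewrite /= expr0n/= add0r sqrtr_sqr. Qed.

Lemma normc_le_ReIm z : normc z <= `|Re z| + `|Im z|.
Proof.
rewrite -[z in normc z](_ : (Re z)%:C + (0 +i* Im z) = z); last first.
  by apply: eq_ReIm; rewrite cReImE/= ?add0r ?addr0.
by rewrite (le_trans (le_normcD _ _))// normc_real normc_i.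
Qed.

Lemma normc_sum I (r : seq I) (F : I -> R[i]) :
  normc (\sum_(i <- r) F i) <= \sum_(i <- r) normc (F i).
Proof.
elim/big_ind2 : _ => // [|x x' y y' xx' yy']; first by rewrite Normc.normc0.
by rewrite (le_trans (le_normcD _ _))// lerD.
Qed.

Lemma normc_expNi x : normc (expNi x) = 1.
Proof. by rewrite /expNi/= sqrrN cos2Dsin2 sqrtr1. Qed.

Lemma expNiD x y : expNi (x + y) = expNi x * expNi y.
Proof.
by apply: eq_ReIm; rewrite /expNi cReImE/= ?cosD ?sinD; ring.
Qed.

End modulus.

Section complex_integral.
Context {R : realType}.
Local Notation mu := (@lebesgue_measure R).
Local Notation Re := (@complex.Re R).
Local Notation Im := (@complex.Im R).
Local Notation cint := (cintegral [set: R]).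
Implicit Types (f g h : R -> R[i]) (c : R[i]) (p : R -> R).

Lemma cmeasurableD f g : cmeasurable f -> cmeasurable g ->
  cmeasurable (fun x => f x + g x).
Proof.
move=> [f1 f2] [g1 g2]; split.
- by under eq_fun do rewrite cReD; exact: measurable_funD.
- by under eq_fun do rewrite cImD; exact: measurable_funD.
Qed.

Lemma cmeasurableM f g : cmeasurable f -> cmeasurable g ->
  cmeasurable (fun x => f x * g x).
Proof.
move=> [f1 f2] [g1 g2]; split.
- under eq_fun do rewrite cReM.
  by apply: measurable_funB; exact: measurable_funM.
- under eq_fun do rewrite cImM.
  by apply: measurable_funD; exact: measurable_funM.
Qed.

Lemma cmeasurable_cst c : cmeasurable (fun=> c).
Proof. by split; exact: measurable_cst. Qed.

Lemma cmeasurableN f : cmeasurable f -> cmeasurable (fun x => - f x).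
Proof.
move=> mf; under eq_fun do rewrite -mulN1r.
by apply: cmeasurableM => //; exact: cmeasurable_cst.
Qed.

Lemma cmeasurable_real p : measurable_fun setT p ->
  cmeasurable (fun x => (p x)%:C).
Proof. by move=> mp; split => //=. Qed.

Lemma ccontinuous_measurable f : ccontinuous f -> cmeasurable f.
Proof. by move=> [f1 f2]; split; exact: continuous_measurable_fun. Qed.

Lemma cmeasurable_normc f : cmeasurable f ->
  measurable_fun setT (fun x => normc (f x)).
Proof.
move=> [f1 f2].
rewrite (_ : (fun x => _) =
  (fun x => Num.sqrt ((Re (f x)) ^+ 2 + (Im (f x)) ^+ 2))); last first.
  by apply/funext => x; case: (f x).
have ms : measurable_fun setT (@Num.sqrt R).
  by apply: continuous_measurable_fun; exact: sqrt_continuous.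
apply: (measurableT_comp ms).
by apply: measurable_funD; exact: measurable_funX.
Qed.

Lemma L1_cmeasurable f : L1 f -> cmeasurable f.
Proof.
move=> [f1 f2]; split; apply/measurable_EFinP.
- exact: measurable_int f1.
- exact: measurable_int f2.
Qed.

Lemma L1_le f p : cmeasurable f -> mu.-integrable setT (EFin \o p) ->
  (forall x, normc (f x) <= p x) -> L1 f.
Proof.
move=> [f1 f2] ip fp; split; apply: le_integrable ip => //.
- exact/measurable_EFinP.
- move=> x _; rewrite /= lee_fin (le_trans (le_Re_normc _))//.
  by rewrite (le_trans (fp x))// ler_norm.
- exact/measurable_EFinP.
- move=> x _; rewrite /= lee_fin (le_trans (le_Im_normc _))//.
  by rewrite (le_trans (fp x))// ler_norm.
Qed.

Lemma L1_normc f : L1 f -> mu.-integrable setT (EFin \o (fun x => normc (f x))).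
Proof.
move=> f1; have [f2 f3] := f1.
have := integrableD measurableT (integrable_abse f2) (integrable_abse f3).
apply: le_integrable => //.
  by apply/measurable_EFinP; apply: cmeasurable_normc; exact: L1_cmeasurable.
move=> x _; rewrite /= lee_fin ger0_norm ?normc_ge0//.
by rewrite ger0_norm ?addr_ge0//; exact: normc_le_ReIm.
Qed.

Lemma L1D f g : L1 f -> L1 g -> L1 (fun x => f x + g x).
Proof.
move=> [f1 f2] [g1 g2]; split.
- by under eq_fun do rewrite cReD EFinD; exact: integrableD.
- by under eq_fun do rewrite cImD EFinD; exact: integrableD.
Qed.

Lemma cintegralD f g : L1 f -> L1 g ->
  cint (fun x => f x + g x) = cint f + cint g.
Proof.
move=> [f1 f2] [g1 g2]; apply: eq_ReIm; rewrite cReImE/=.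
- by under eq_Rintegral do rewrite cReD; rewrite RintegralD.
- by under eq_Rintegral do rewrite cImD; rewrite RintegralD.
Qed.

Lemma integrable_rl (c : R) p : mu.-integrable setT (EFin \o p) ->
  mu.-integrable setT (EFin \o (fun x => c * p x)).
Proof.
move=> ip; rewrite (_ : _ \o _ = fun x => (c%:E * (EFin \o p) x)%E)//.
exact: integrableZl.
Qed.

Lemma L1Zl c f : L1 f -> L1 (fun x => c * f x).
Proof.
move=> f1; apply: (@L1_le _ (fun x => normc c * normc (f x))).
- apply: cmeasurableM; first exact: cmeasurable_cst.
  exact: L1_cmeasurable.
- exact/integrable_rl/L1_normc.
- by move=> x; rewrite normcM.
Qed.

Lemma cintegralZl c f : L1 f -> cint (fun x => c * f x) = c * cint f.
Proof.
move=> [f1 f2]; apply: eq_ReIm; rewrite cReImE/=.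
- under eq_Rintegral do rewrite cReM.
  by rewrite RintegralB ?RintegralZl//; exact: integrable_rl.
- under eq_Rintegral do rewrite cImM.
  by rewrite RintegralD ?RintegralZl//; exact: integrable_rl.
Qed.

Lemma cintegralB f g : L1 f -> L1 g ->
  cint (fun x => f x - g x) = cint f - cint g.
Proof.
move=> f1 g1; rewrite -[X in _ = _ + X]mulN1r -cintegralZl// -cintegralD//.
  by congr cintegral; apply/funext => x; rewrite mulN1r.
exact: L1Zl.
Qed.

Lemma L1B f g : L1 f -> L1 g -> L1 (fun x => f x - g x).
Proof.
move=> f1 g1; under eq_fun do rewrite -[X in _ + X]mulN1r.
by apply: L1D => //; exact: L1Zl.
Qed.

Lemma L1_0 : L1 (fun=> 0 : R[i]).
Proof. by split; exact: integrable0. Qed.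

Lemma cintegral0 : cint (fun=> 0) = 0.
Proof. by apply: eq_ReIm; rewrite /= /Rintegral integral0. Qed.

Lemma L1_sum I (r : seq I) (F : I -> R -> R[i]) : (forall i, L1 (F i)) ->
  L1 (fun x => \sum_(i <- r) F i x).
Proof.
move=> F1; elim: r => [|i r ih].
  by under eq_fun do rewrite big_nil; exact: L1_0.
by under eq_fun do rewrite big_cons; exact: L1D.
Qed.

Lemma cintegral_sum I (r : seq I) (F : I -> R -> R[i]) :
  (forall i, L1 (F i)) ->
  cint (fun x => \sum_(i <- r) F i x) = \sum_(i <- r) cint (F i).
Proof.
move=> F1; elim: r => [|i r ih].
  by rewrite big_nil; under eq_fun do rewrite big_nil; exact: cintegral0.
rewrite big_cons -ih -cintegralD//; last exact: L1_sum.
by congr cintegral; apply/funext => x; rewrite big_cons.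
Qed.

(** The factor 2 comes from bounding the real and the imaginary part separately. The sharp constant
    would need a rotation of the integral by a unit phase; only smallness or finiteness of the bound
    matters below. *)
Lemma normc_cintegral_le f p : cmeasurable f ->
  mu.-integrable setT (EFin \o p) -> (forall x, normc (f x) <= p x) ->
  normc (cint f) <= 2 * \int[mu]_x p x.
Proof.
move=> mf ip fp; have [f1 f2] := L1_le mf ip fp.
rewrite (le_trans (normc_le_ReIm _))//= mulr_natl mulr2n lerD//.
- rewrite (le_trans (le_normr_Rintegral _ _))//; apply: le_Rintegral => //.
    exact: integrable_abse f1.
  by move=> x _; rewrite (le_trans (le_Re_normc _)).
- rewrite (le_trans (le_normr_Rintegral _ _))//; apply: le_Rintegral => //.
    exact: integrable_abse f2.
  by move=> x _; rewrite (le_trans (le_Im_normc _)).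
Qed.

Lemma eq_cintegral (D : set R) f g : f =1 g -> cintegral D f = cintegral D g.
Proof. by move=> fg; congr cintegral; exact/funext. Qed.

Lemma cintegral_mkcond (D : set R) f :
  cintegral D f = cint (fun x => (\1_D x)%:C * f x).
Proof.
apply: eq_ReIm => /=; rewrite Rintegral_mkcond; apply: eq_Rintegral => x _;
  rewrite cReImE/= patchE indicE; case: (x \in D) => /=;
  by rewrite ?mul1r ?mul0r ?subr0 ?addr0.
Qed.

Lemma ae_eq_cintegral (D : set R) f g : measurable D ->
  cmeasurable f -> cmeasurable g ->
  {ae mu, forall x, f x = g x} -> cintegral D f = cintegral D g.
Proof.
move=> mD [f1 f2] [g1 g2] fg.
have FF : Filter (almost_everywhere mu) by exact: ae_filter_ringOfSetsType.
apply: eq_ReIm => /=; congr fine;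
  apply: ae_eq_integral => //; try (apply/measurable_EFinP; exact: measurable_funTS).
- by apply: filterS fg => x /= ->.
- by apply: filterS fg => x /= ->.
Qed.

End complex_integral.

(** * Fubini's theorem and reflections *)

Section fubini.
Context {R : realType}.
Local Notation mu := (@lebesgue_measure R).
Local Notation Re := (@complex.Re R).
Local Notation Im := (@complex.Im R).
Local Notation cint := (cintegral [set: R]).
Implicit Types (f g h : R -> R[i]) (c : R[i]) (p : R -> R).
Implicit Types (k : R -> R -> R[i]).

Definition cmeasurable2 k :=
  measurable_fun [set: R * R] (fun z => Re (k z.1 z.2)) /\
  measurable_fun [set: R * R] (fun z => Im (k z.1 z.2)).

(** Integrability in [y] plays no part: the extended integral is the difference of those of the
    positive and negative parts, each measurable in [x] by Tonelli, and [fine] is measurable. *)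
Lemma measurable_param_integral (q : R * R -> R) : measurable_fun setT q ->
  measurable_fun setT (fun x => \int[mu]_y q (x, y)).
Proof.
move=> mq; have mQ : measurable_fun setT (EFin \o q) by exact/measurable_EFinP.
rewrite /Rintegral; apply: (measurableT_comp (f := fine)) => //.
rewrite (_ : (fun x => _) = ((fun x => \int[mu]_y (EFin \o q)^\+ (x, y)) \-
   (fun x => \int[mu]_y (EFin \o q)^\- (x, y)))%E); last first.
  apply/funext => x; rewrite [LHS]integralE.
  by congr (_ - _)%E; apply: eq_integral => y _; rewrite ?funeposE ?funenegE.
apply: emeasurable_funB; apply: measurable_fun_fubini_tonelli_F => //.
  exact: measurable_funepos.
exact: measurable_funeneg.
Qed.

Lemma cmeasurable_param k : cmeasurable2 k ->
  cmeasurable (fun x => cint (k x)).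
Proof.
by move=> [k1 k2]; split; exact: (measurable_param_integral (q := fun z => _ (k z.1 z.2))).
Qed.

Lemma integrable_prod_le (q : R * R -> R) p : measurable_fun setT q ->
  mu.-integrable setT (EFin \o p) ->
  (forall x, \int[mu]_y `|q (x, y)|%:E <= (p x)%:E)%E ->
  (mu \x mu)%E.-integrable setT (EFin \o q).
Proof.
move=> mq ip qp; have mQ : measurable_fun setT (EFin \o q) by exact/measurable_EFinP.
apply/integrable12ltyP => //.
have/integrableP[_] := ip; apply: le_lt_trans.
apply: ge0_le_integral => //.
- by move=> x _; exact: integral_ge0.
- have mA : measurable_fun setT (abse \o (EFin \o q)) by exact: measurableT_comp.
  by have := measurable_fun_fubini_tonelli_F (m2 := mu) _ mA (fun z => abse_ge0 _).
- by apply: measurableT_comp => //; exact: measurable_int ip.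
- move=> x _ /=; rewrite (le_trans (qp x))// lee_fin; exact: ler_norm.
Qed.

(** The bound [p] gives integrability on the product by Tonelli. The sections are asked to be
    integrable at every point so that the real-valued inner integrals coincide everywhere with the
    extended ones that Fubini's theorem handles. *)
Lemma cfubini k p : cmeasurable2 k -> mu.-integrable setT (EFin \o p) ->
  (forall x, L1 (k x)) -> (forall y, L1 (k^~ y)) ->
  (forall x, \int[mu]_y normc (k x y) <= p x) ->
  cint (fun x => cint (k x)) = cint (fun y => cint (k^~ y)).
Proof.
move=> [k1 k2] ip kx ky kp.
have kpE x : (\int[mu]_y (normc (k x y))%:E <= (p x)%:E)%E.
  rewrite -(fineK (integrable_fin_num _ (L1_normc (kx x))))// lee_fin.
  exact: kp.
have i1 : (mu \x mu)%E.-integrable setT (EFin \o (fun z => Re (k z.1 z.2))).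
  apply: (integrable_prod_le k1 ip) => x; apply: le_trans (kpE x).
  apply: ge0_le_integral => //.
  - by apply: measurable_int (integrable_abse (kx x).1).
  - exact: measurable_int (L1_normc (kx x)).
  - by move=> y _; rewrite lee_fin le_Re_normc.
have i2 : (mu \x mu)%E.-integrable setT (EFin \o (fun z => Im (k z.1 z.2))).
  apply: (integrable_prod_le k2 ip) => x; apply: le_trans (kpE x).
  apply: ge0_le_integral => //.
  - by apply: measurable_int (integrable_abse (kx x).2).
  - exact: measurable_int (L1_normc (kx x)).
  - by move=> y _; rewrite lee_fin le_Im_normc.
have e1 x : ((\int[mu]_y Re (k x y))%:E = \int[mu]_y (Re (k x y))%:E)%E.
  by rewrite fineK//; exact: integrable_fin_num (kx x).1.
have e2 x : ((\int[mu]_y Im (k x y))%:E = \int[mu]_y (Im (k x y))%:E)%E.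
  by rewrite fineK//; exact: integrable_fin_num (kx x).2.
have e3 y : ((\int[mu]_x Re (k x y))%:E = \int[mu]_x (Re (k x y))%:E)%E.
  by rewrite fineK//; exact: integrable_fin_num (ky y).1.
have e4 y : ((\int[mu]_x Im (k x y))%:E = \int[mu]_x (Im (k x y))%:E)%E.
  by rewrite fineK//; exact: integrable_fin_num (ky y).2.
apply: eq_ReIm => /=; congr fine.
- under eq_integral do rewrite e1.
  under [RHS]eq_integral do rewrite e3.
  exact: (Fubini i1).
- under eq_integral do rewrite e2.
  under [RHS]eq_integral do rewrite e4.
  exact: (Fubini i2).
Qed.

End fubini.


Section reflection.
Context {R : realType}.
Local Notation mu := (@lebesgue_measure R).
Local Notation cint := (cintegral [set: R]).
Implicit Types (f : R -> R[i]) (p : R -> R) (q : R -> \bar R).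

Let phi x : measurableTypeR R -> measurableTypeR R := fun s => x - s.

Let mphi x : measurable_fun [set: measurableTypeR R] (phi x).
Proof. by apply: measurable_funB. Qed.

(** Lebesgue measure is determined by the lengths of half-open intervals, and the reflection turns
    []a, b]] into [[x - b, x - a[]. *)
Let muphi x (A : set (measurableTypeR R)) :
  measurable A -> mu A = pushforward mu (phi x) A.
Proof.
move=> mA; apply: lebesgue_measure_unique => //= _ [[a b]] _ <-.
rewrite /pushforward (_ : _ @^-1` _ = `[x - b, x - a[%classic); last first.
  by apply/seteqP; split=> y /=; rewrite /phi !in_itv/=; lra.
rewrite !lebesgue_measure_itv/= !lte_fin -!EFinD.
by rewrite ltrD2l ltrN2; case: ifP => // _; congr EFin; ring.
Qed.

Lemma ge0_integral_reflect x q : measurable_fun setT q -> (forall s, 0 <= q s)%E ->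
  (\int[mu]_s q (x - s)%R = \int[mu]_s q s)%E.
Proof.
move=> mq q0; transitivity (\int[pushforward mu (phi x)]_s q s)%E.
  by rewrite ge0_integral_pushforward.
by apply: eq_measure_integral => //= A mA _; rewrite -muphi.
Qed.

Lemma integrable_reflect x p : mu.-integrable setT (EFin \o p) ->
  mu.-integrable setT (EFin \o (fun s => p (x - s))).
Proof.
move=> /integrableP[mp ip]; apply/integrableP; split.
  apply: (measurableT_comp mp); exact: mphi.
rewrite (ge0_integral_reflect x (q := abse \o (EFin \o p)))//.
  exact: measurableT_comp.
by move=> s; exact: abse_ge0.
Qed.

Lemma Rintegral_reflect x p : mu.-integrable setT (EFin \o p) ->
  \int[mu]_s p (x - s) = \int[mu]_s p s.
Proof.
move=> ip; congr fine; transitivity (\int[pushforward mu (phi x)]_s (p s)%:E)%E.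
  rewrite integral_pushforward//.
  - exact: measurable_int ip.
  - exact: integrable_reflect.
by apply: eq_measure_integral => //= A mA _; rewrite -muphi.
Qed.

Lemma L1_reflect x f : L1 f -> L1 (fun s => f (x - s)).
Proof.
move=> [f1 f2]; split.
- exact: (integrable_reflect x (p := fun s => complex.Re (f s))).
- exact: (integrable_reflect x (p := fun s => complex.Im (f s))).
Qed.

Lemma cintegral_reflect x f : L1 f -> cint (fun s => f (x - s)) = cint f.
Proof.
move=> [f1 f2]; apply: eq_ReIm.
- exact: (Rintegral_reflect x (p := fun s => complex.Re (f s))).
- exact: (Rintegral_reflect x (p := fun s => complex.Im (f s))).
Qed.

(** A translation is the composition of the reflections [s |-> x - s] and [s |-> 0 - s]. *)
Lemma cintegral_shift x f : L1 f -> cint (fun s => f (s - x)) = cint f.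
Proof.
move=> f1; rewrite -(cintegral_reflect 0 f1) -(cintegral_reflect x (f := fun s => f (0 - s))).
  by congr cintegral; apply/funext => s; congr f; ring.
exact: L1_reflect.
Qed.

End reflection.

(** * Calculus and functions of bounded variation *)

Section calculus.
Context {R : realType}.
Local Notation Re := (@complex.Re R).
Local Notation Im := (@complex.Im R).
Implicit Types (f g : R -> R[i]) (c d : R[i]) (x y t : R).

Lemma is_cderive_cst c x : is_cderive (fun=> c) x 0.
Proof. by split; exact: is_derive_cst. Qed.

Lemma is_cderiveD f g x c d : is_cderive f x c -> is_cderive g x d ->
  is_cderive (fun y => f y + g y) x (c + d).
Proof.
move=> [f1 f2] [g1 g2]; split.
- by rewrite cReD; under eq_fun do rewrite cReD; exact: is_deriveD.
- by rewrite cImD; under eq_fun do rewrite cImD; exact: is_deriveD.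
Qed.

Lemma is_cderiveM f g x c d : is_cderive f x c -> is_cderive g x d ->
  is_cderive (fun y => f y * g y) x (c * g x + f x * d).
Proof.
move=> [f1 f2] [g1 g2]; split.
- under eq_fun do rewrite cReM.
  have h := is_deriveB (is_deriveM f1 g1) (is_deriveM f2 g2).
  apply: (is_derive_eq h).
  rewrite !cReImE /GRing.scale/=. ring.
- under eq_fun do rewrite cImM.
  have h := is_deriveD (is_deriveM f1 g2) (is_deriveM f2 g1).
  apply: (is_derive_eq h).
  rewrite !cReImE /GRing.scale/=. ring.
Qed.

Lemma is_cderiveZ c f x d : is_cderive f x d ->
  is_cderive (fun y => c * f y) x (c * d).
Proof.
by move=> /(is_cderiveM (is_cderive_cst c x)); rewrite mul0r add0r.
Qed.

Lemma is_cderive_expNi t x :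
  is_cderive (fun s => expNi (s * t)) x ((0 -i* t) * expNi (x * t)).
Proof.
have dl : is_derive x 1 (fun s : R => s * t) t.
  have h := is_deriveM (is_derive_id x 1) (is_derive_cst t x 1).
  by apply: (is_derive_eq h); rewrite /GRing.scale/=; ring.
have dc := @is_derive1_comp _ (@cos R) (fun s => s * t) x _ _ (is_derive_cos _) dl.
have ds := @is_derive1_comp _ (@sin R) (fun s => s * t) x _ _ (is_derive_sin _) dl.
split=> /=.
- by apply: (is_derive_eq dc); rewrite /=; ring.
- by apply: (is_derive_eq (is_deriveN ds)); rewrite /=; ring.
Qed.

Lemma is_cderive_continuous f g :
  (forall x, is_cderive f x (g x)) -> ccontinuous f.
Proof.
move=> fg; split=> x; have [[d1 _] [d2 _]] := fg x.
- by apply: differentiable_continuous; exact/derivable1_diffP.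
- by apply: differentiable_continuous; exact/derivable1_diffP.
Qed.

Lemma MVT_bound (p dp : R -> R) x y (C : R) : x <= y ->
  (forall z : R, is_derive z 1 p (dp z)) ->
  (forall z, x <= z <= y -> `|dp z| <= C) ->
  `|p y - p x| <= C * (y - x).
Proof.
move=> xy pdp dpC.
have cp : {within `[x, y], continuous p}.
  apply: continuous_subspaceT => z.
  by apply: differentiable_continuous; apply/derivable1_diffP; case: (pdp z).
have [z + ->] := MVT_segment xy (fun z _ => pdp z) cp.
rewrite in_itv/= => xzy; rewrite normrM (ger0_norm (x := y - x)) ?subr_ge0//.
by rewrite ler_wpM2r ?subr_ge0// dpC.
Qed.

(** The mean value equality fails for complex values, so it is applied to the real and to the
    imaginary part; hence the factor 2. *)
Lemma cMVT_bound f g x y (C : R) : x <= y ->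
  (forall z, is_cderive f z (g z)) ->
  (forall z, x <= z <= y -> normc (g z) <= C) ->
  normc (f y - f x) <= 2 * C * (y - x).
Proof.
move=> xy fg gC; rewrite (le_trans (normc_le_ReIm _))// cReB cImB.
rewrite -mulrA mulr_natl mulr2n lerD//.
- apply: (@MVT_bound (fun z => Re (f z)) (fun z => Re (g z))) => //.
  + by move=> z; have [] := fg z.
  + by move=> z /gC; apply: le_trans; exact: le_Re_normc.
- apply: (@MVT_bound (fun z => Im (f z)) (fun z => Im (g z))) => //.
  + by move=> z; have [] := fg z.
  + by move=> z /gC; apply: le_trans; exact: le_Im_normc.
Qed.

End calculus.

Section variation.
Context {R : realType}.
Local Notation Re := (@complex.Re R).
Local Notation Im := (@complex.Im R).
Implicit Types (f g k K G : R -> R[i]) (N : R -> R).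

(** [N] stands in for the total variation function: sums, products and tails of variations become
    inequalities between increments of real functions. *)
Definition dominates_increments N f :=
  forall x y, x <= y -> normc (f y - f x) <= N y - N x.

Definition brange N (V : R) := forall x, 0 <= N x <= V.

Lemma node_size (a b : R) s : itv_partition a b s -> node a b s (size s) = b.
Proof. by move=> [_ /eqP]; rewrite /node -last_nth. Qed.

Lemma node_lt (a b : R) s i : itv_partition a b s -> (i < size s)%N ->
  node a b s i < node a b s i.+1.
Proof. by move=> [/(pathP b) h _] /h. Qed.

Lemma telescope_partition N (a b : R) s : itv_partition a b s ->
  \sum_(0 <= i < size s) (N (node a b s i.+1) - N (node a b s i)) = N b - N a.
Proof.
by move=> ab; rewrite (telescope_sumr (fun i => N (node a b s i)))// node_size.
Qed.

Lemma dominated_bv N V f : brange N V -> dominates_increments N f -> bv f.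
Proof.
move=> NV Nf; exists V => a b s ab.
apply: (@le_trans _ _ (N b - N a)); last first.
  by have /andP[a0 _] := NV a; have /andP[_ bV] := NV b; lra.
rewrite -(telescope_partition N ab) !big_nat; apply: ler_sum => i /andP[_ iS].
by apply: Nf; rewrite ltW// node_lt.
Qed.

Let variations f x := [set S : R | exists a s, itv_partition a x s /\
  S = \sum_(0 <= i < size s) normc (f (node a x s i.+1) - f (node a x s i))].

(** [N x] is the total variation on []-oo, x]], a supremum over partitions that end at [x].
    Adjoining [y] to such a partition adds exactly [normc (f y - f x)] to its sum. *)
Lemma bv_dominated f : bv f -> exists N V, brange N V /\ dominates_increments N f.
Proof.
move=> [V fV]; exists (fun x => sup (variations f x)), V.
have ub x : ubound (variations f x) V by move=> _ [a [s [ax ->]]]; exact: fV.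
have v0 x : variations f x 0.
  by exists x, [::]; split; [split => /=|rewrite big_nil].
have hub x : has_ubound (variations f x) by exists V.
split=> [x|x y].
  by rewrite (ub_le_sup (hub x))//=; apply: ge_sup => //; exists 0.
rewrite le_eqVlt => /predU1P[->|xy]; first by rewrite !subrr Normc.normc0.
rewrite lerBrDr -lerBrDl; apply: ge_sup; first by exists 0.
move=> _ [a [s [ax ->]]]; rewrite lerBrDl; apply: ub_le_sup => //.
exists a, (rcons s y); split.
  move: ax => [p1 /eqP p2]; split; last by rewrite last_rcons.
  by rewrite rcons_path p1 p2.
have nodeE i : (i <= size s)%N -> node a y (rcons s y) i = node a x s i.
  by move=> si; rewrite /node -rcons_cons nth_rcons/= ltnS si; apply: set_nth_default.
rewrite size_rcons big_nat_recr//= [LHS]addrC; congr (_ + _).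
  by rewrite !big_nat; apply: eq_bigr => i /andP[_ iS]; rewrite !nodeE// ltnW.
rewrite (nodeE (size s))// (node_size ax); congr (normc (f _ - _)).
by rewrite /node -rcons_cons nth_rcons/= ltnn eqxx.
Qed.

(** A bounded monotone [N] is within [e] of its supremum from some [x1] on and within [e] of its
    infimum up to some [x2]; [A] is chosen beyond both in absolute value. *)
Lemma brange_tail N V (e : R) : brange N V -> {homo N : x y / x <= y} -> 0 < e ->
  exists2 A, 0 < A & forall x y, x <= y -> A <= x \/ y <= - A -> N y - N x < e.
Proof.
move=> NV Ni e0; pose S := range N.
have S0 : S !=set0 by exists (N 0), 0.
have hs : has_sup S by split => //; exists V => _ [x _ <-]; have /andP[] := NV x.
have hi : has_inf S by split => //; exists 0 => _ [x _ <-]; have /andP[] := NV x.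
have [_ [x1 _ <-] h1] := sup_adherent e0 hs.
have [_ [x2 _ <-] h2] := inf_adherent e0 hi.
exists (1 + `|x1| + `|x2|); first by rewrite -addrA ltr_pwDl.
move=> x y xy [Ax|yA].
- have : N x1 <= N x.
    apply: Ni; rewrite (le_trans _ Ax)// (le_trans (ler_norm _))//.
    by rewrite addrAC lerDr addr_ge0.
  have : N y <= sup S by apply: (sup_upper_bound hs); exists y.
  lra.
- have : N y <= N x2.
    apply: Ni; rewrite (le_trans yA)// lerNl.
    by rewrite (le_trans (ler_norm _))// normrN lerDr addr_ge0.
  have : inf S <= N x by apply: (ge_inf hi.2); exists x.
  lra.
Qed.

Lemma dominates_homo N f : dominates_increments N f -> {homo N : x y / x <= y}.
Proof.
by move=> Nf x y /Nf; rewrite -(subr_ge0 (N x)); apply: le_trans; exact: normc_ge0.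
Qed.

Lemma bv_bounded f : bv f -> exists B : R, forall x, normc (f x) <= B.
Proof.
move=> /bv_dominated[N [V [NV Nf]]]; exists (normc (f 0) + V) => x.
rewrite -[f x](subrKC (f 0)) (le_trans (le_normcD _ _))// lerD2l.
have /andP[? ?] := NV 0; have /andP[? ?] := NV x.
have [x0|x0] := leP 0 x; first by rewrite (le_trans (Nf _ _ x0))//; lra.
by rewrite normc_distC (le_trans (Nf _ _ (ltW x0)))//; lra.
Qed.

Lemma bvD f g : bv f -> bv g -> bv (fun x => f x + g x).
Proof.
move=> /bv_dominated[N [V [NV Nf]]] /bv_dominated[M [W [MW Mg]]].
apply: (@dominated_bv (fun x => N x + M x) (V + W)).
  by move=> x; have /andP[? ?] := NV x; have /andP[? ?] := MW x; apply/andP; lra.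
move=> x y xy; rewrite (_ : _ - _ = (f y - f x) + (g y - g x)); last ring.
have := Nf _ _ xy; have := Mg _ _ xy.
by have := le_normcD (f y - f x) (g y - g x); lra.
Qed.

(* The value of [k] on [[x, y]] is compared with the mean slope of [K]. *)
Lemma derivative_min_increment N M k K x y :
  (forall z, is_cderive K z (k z)) ->
  dominates_increments N k -> dominates_increments M K -> x <= y ->
  normc (k x) * Num.min (y - x) 1 <= 2 * ((N y - N x) + (M y - M x)).
Proof.
move=> Kk Nk MK xy; set m := Num.min _ _.
have m0 : 0 <= m by rewrite le_min subr_ge0 xy ler01.
have m1 : m <= 1 by rewrite ge_min lexx orbT.
have xm : x <= x + m by rewrite lerDl.
have my : x + m <= y by rewrite -lerBrDl ge_min lexx.
have MI := dominates_homo MK; have NI := dominates_homo Nk.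
have KM : normc (K (x + m) - K x) <= M y - M x.
  by rewrite (le_trans (MK _ _ xm))// lerD2r MI.
(* [P] will be [Re] or [Im], since the mean value point [c] depends on the real function.
   [P (k c) * m] is an increment of [P] composed with [K], and replacing [k x] by [k c] costs an
   increment of [N] times [m <= 1]. *)
have step (P : R[i] -> R) : (forall z : R, is_derive z 1 (fun x => P (K x)) (P (k z))) ->
  (forall z, `|P z| <= normc z) -> {morph P : z w / z - w} ->
  `|P (k x)| * m <= (N y - N x) + (M y - M x).
  move=> dP Pn PB.
  have cp : {within `[x, x + m], continuous (fun x => P (K x))}.
    apply: continuous_subspaceT => z.
    by apply: differentiable_continuous; apply/derivable1_diffP; case: (dP z).
  have [c + ] := MVT_segment xm (fun z _ => dP z) cp.
  rewrite in_itv/= => /andP[xc cm]; rewrite (addrC x m) addrK -PB (addrC m x) => E.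
  rewrite -[P (k x)](subrK (P (k c))) (@le_trans _ _ (`|P (k x) - P (k c)| + `|P (k c)| * m))//.
    rewrite (le_trans (ler_wpM2r m0 (ler_normD _ _)))// mulrDl lerD2r.
    by rewrite ler_piMr.
  rewrite -[X in _ + _ * X](ger0_norm m0) -normrM -E lerD//; last first.
    by rewrite (le_trans (Pn _)).
  rewrite -PB (le_trans (Pn _))// normc_distC (le_trans (Nk _ _ xc))//.
  by rewrite lerD2r NI// (le_trans cm).
rewrite (@le_trans _ _ ((`|Re (k x)| + `|Im (k x)|) * m))//.
  by rewrite ler_wpM2r// normc_le_ReIm.
rewrite mulrDl mulr_natl mulr2n lerD//; apply: step.
- by move=> z; have [] := Kk z.
- exact: le_Re_normc.
- exact: cReB.
- by move=> z; have [] := Kk z.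
- exact: le_Im_normc.
- exact: cImB.
Qed.

Definition vanishes_at_infinity f := forall e : R, 0 < e ->
  exists A, forall x, A <= `|x| -> normc (f x) < e.

(** Far from the origin the variations of [k] and of [K] on [[x, x + 1]] are both below [e / 4], and
    [derivative_min_increment] bounds [normc (k x)] by twice their sum. *)
Lemma bv_derivative_vanishes k K :
  (forall z, is_cderive K z (k z)) -> bv k -> bv K -> vanishes_at_infinity k.
Proof.
move=> Kk /bv_dominated[N [V [NV Nk]]] /bv_dominated[M [W [MW MK]]] e e0.
have e4 : 0 < e / 4 by rewrite divr_gt0.
have [A A0 NA] := brange_tail NV (dominates_homo Nk) e4.
have [B B0 MB] := brange_tail MW (dominates_homo MK) e4.
(* The extra [1] keeps [x + 1] below [- A] and [- B] when [x] is negative. *)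
exists (A + B + 1) => x ABx.
have xx1 : x <= x + 1 by rewrite lerDl.
have := derivative_min_increment Kk Nk MK xx1.
rewrite (_ : x + 1 - x = 1) ?minxx ?mulr1; last by ring.
move=> h; apply: le_lt_trans h _.
have h : A <= x \/ x + 1 <= - A.
  by have [x0|x0] := leP 0 x; move: ABx; [rewrite ger0_norm//|rewrite ltr0_norm//]; lra.
have h' : B <= x \/ x + 1 <= - B.
  by have [x0|x0] := leP 0 x; move: ABx; [rewrite ger0_norm//|rewrite ltr0_norm//]; lra.
by have := NA _ _ xx1 h; have := MB _ _ xx1 h'; lra.
Qed.

Lemma vanishesD f g : vanishes_at_infinity f -> vanishes_at_infinity g ->
  vanishes_at_infinity (fun x => f x + g x).
Proof.
move=> f0 g0 e e0; have e2 : 0 < e / 2 by rewrite divr_gt0.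
have [A fA] := f0 _ e2; have [B gB] := g0 _ e2.
exists (Num.max A B) => x; rewrite ge_max => /andP[/fA ? /gB ?].
by rewrite (le_lt_trans (le_normcD _ _))//; lra.
Qed.

Lemma vanishesMl G f (B : R) : (forall x, normc (G x) <= B) ->
  vanishes_at_infinity f -> vanishes_at_infinity (fun x => G x * f x).
Proof.
move=> GB f0 e e0; have B0 : 0 <= B := le_trans (normc_ge0 (G 0)) (GB 0).
have [|A fA] := f0 (e / (B + 1)); first by rewrite divr_gt0// ltr_wpDl.
exists A => x /fA; rewrite ltr_pdivlMr ?ltr_wpDl// normcM => h.
apply: le_lt_trans h; rewrite mulrC ler_wpM2l ?normc_ge0//.
by rewrite (le_trans (GB x))// lerDl.
Qed.

Lemma bvMl G k K (B L : R) : (forall x, normc (G x) <= B) ->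
  (forall x y, x <= y -> normc (G y - G x) <= L * (y - x)) ->
  (forall z, is_cderive K z (k z)) -> bv k -> bv K ->
  bv (fun x => G x * k x).
Proof.
move=> GB GL Kk /bv_dominated[N [V [NV Nk]]] /bv_dominated[M [W [MW MK]]].
have B0 : 0 <= B := le_trans (normc_ge0 (G 0)) (GB 0).
pose C := 2 * B + `|L|.
have C0 : 0 <= C by rewrite addr_ge0// mulr_ge0.
apply: (@dominated_bv (fun x => B * N x + C * (2 * (N x + M x)))
    (B * V + C * (2 * (V + W)))).
  move=> x; have /andP[? ?] := NV x; have /andP[? ?] := MW x; apply/andP; split.
    by rewrite addr_ge0// mulr_ge0// mulr_ge0// addr_ge0.
  by rewrite lerD// ler_wpM2l// ler_wpM2l// lerD.
move=> x y xy.
have Gm : normc (G y - G x) <= C * Num.min (y - x) 1.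
  have [h|h] := leP (y - x) 1.
    rewrite (le_trans (GL _ _ xy))// ler_wpM2r ?subr_ge0//.
    by rewrite (le_trans (ler_norm _))// lerDr mulr_ge0.
  rewrite mulr1 (le_trans (le_normcD _ _))// normcN.
  by have := GB x; have := GB y; have := normr_ge0 L; rewrite /C; lra.
rewrite (_ : _ - _ = G y * (k y - k x) + (G y - G x) * k x); last ring.
rewrite (le_trans (le_normcD _ _))// !normcM.
have h1 : normc (G y) * normc (k y - k x) <= B * (N y - N x).
  by rewrite ler_pM ?normc_ge0// Nk.
have h2 : normc (G y - G x) * normc (k x) <= C * (2 * ((N y - N x) + (M y - M x))).
  rewrite (le_trans (ler_wpM2r (normc_ge0 _) Gm))// -mulrA ler_wpM2l//.
  by rewrite mulrC; exact: (derivative_min_increment Kk).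
by lra.
Qed.

End variation.

(** * Primitives of integrable functions *)

Section measurability_two_variables.
Context {R : realType}.
Implicit Types (f : R -> R[i]) (k l : R -> R -> R[i]).

Lemma cmeasurable2M k l : cmeasurable2 k -> cmeasurable2 l ->
  cmeasurable2 (fun x y => k x y * l x y).
Proof.
move=> [k1 k2] [l1 l2]; split.
- under eq_fun do rewrite cReM.
  by apply: measurable_funB; exact: measurable_funM.
- under eq_fun do rewrite cImM.
  by apply: measurable_funD; exact: measurable_funM.
Qed.

Lemma cmeasurable2_comp f (q : R * R -> R) : cmeasurable f ->
  measurable_fun setT q -> cmeasurable2 (fun x y => f (q (x, y))).
Proof.
move=> [f1 f2] mq; split.
- by apply: (measurableT_comp f1); under eq_fun do rewrite -surjective_pairing.
- by apply: (measurableT_comp f2); under eq_fun do rewrite -surjective_pairing.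
Qed.

Lemma cmeasurable2_fst f : cmeasurable f -> cmeasurable2 (fun x _ => f x).
Proof. by move=> /(cmeasurable2_comp (q := fst)); apply. Qed.

Lemma cmeasurable2_snd f : cmeasurable f -> cmeasurable2 (fun _ y => f y).
Proof. by move=> /(cmeasurable2_comp (q := snd)); apply. Qed.

Lemma cmeasurable2_sub f : cmeasurable f -> cmeasurable2 (fun x y => f (x - y)).
Proof.
move=> /(cmeasurable2_comp (q := fun z => z.1 - z.2)); apply.
by apply: measurable_funB.
Qed.

Lemma cmeasurable_expNi : cmeasurable (@expNi R).
Proof.
apply: ccontinuous_measurable; split; first exact: continuous_cos.
by move=> x; apply: (@cvgN _ R); exact: continuous_sin.
Qed.

Lemma cmeasurable2_expNi : cmeasurable2 (fun x y : R => expNi (x * y)).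
Proof.
have /(cmeasurable2_comp (q := fun z => z.1 * z.2)) := cmeasurable_expNi.
by apply; apply: measurable_funM.
Qed.

Lemma cmeasurable2_swap k : cmeasurable2 k -> cmeasurable2 (fun x y => k y x).
Proof.
move=> [k1 k2]; split.
- by apply: (measurableT_comp k1 (g := fun z => (z.2, z.1))); exact: measurable_swap.
- by apply: (measurableT_comp k2 (g := fun z => (z.2, z.1))); exact: measurable_swap.
Qed.

Lemma cmeasurable_section k x : cmeasurable2 k -> cmeasurable (k x).
Proof.
move=> [k1 k2]; split.
- by apply: (measurableT_comp k1 (g := fun y => (x, y))); exact: measurable_pair1.
- by apply: (measurableT_comp k2 (g := fun y => (x, y))); exact: measurable_pair1.
Qed.

End measurability_two_variables.

(** * Integrable majorants and dominated convergence *)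

Section dominated.
Context {R : realType}.
Local Notation mu := (@lebesgue_measure R).
Local Notation cint := (cintegral [set: R]).
Implicit Types (f : R -> R[i]) (p : R -> R).

(** Up to constants, this function dominates the weight [t ^- 2] on [1 < |t|], the indicator of
    [[-1, 1]] and the transforms [fourier u]. *)
Lemma integrable_oneDsqrV :
  mu.-integrable setT (EFin \o (fun t : R => (1 + t ^+ 2)^-1)).
Proof.
have mc : measurable_fun [set: R] (fun t : R => (1 + t ^+ 2)^-1).
  by apply: continuous_measurable_fun; exact: continuous_oneDsqrV.
apply/integrableP; split; first exact/measurable_EFinP.
under eq_integral.
  move=> t _; rewrite /= ger0_norm ?invr_ge0 ?addr_ge0 ?sqr_ge0//; over.
rewrite ge0_symfun_integralT//.
- by have /= := @integral0y_oneDsqr R; rewrite /oneDsqr set_itvcy => ->; rewrite -EFinM ltry.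
- by move=> t; rewrite invr_ge0 addr_ge0// sqr_ge0.
- exact: continuous_oneDsqrV.
- by move=> t /=; rewrite sqrrN.
Qed.

Lemma dominated_convergence0 (q : nat -> R -> R) p (e : R) :
  (forall n, measurable_fun setT (q n)) -> mu.-integrable setT (EFin \o p) ->
  (forall n x, 0 <= q n x <= p x) -> (forall x, q ^~ x @ \oo --> 0) ->
  0 < e -> exists n, \int[mu]_x q n x < e.
Proof.
move=> mq ip qp q0 e0.
have iq n : mu.-integrable setT (EFin \o q n).
  apply: le_integrable ip => //; first by apply/measurable_EFinP; exact: mq.
  move=> x _; have /andP[h1 h2] := qp n x.
  by rewrite /= lee_fin !ger0_norm// (le_trans h1).
have [] := @dominated_convergence _ _ _ mu setT measurableT
  (fun n => EFin \o q n) (fun=> 0%E) (EFin \o p).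
- by move=> n; apply/measurable_EFinP; exact: mq.
- exact: measurable_cst.
- by apply: aeW => x _; apply/fine_cvgP; split; [exact: nearW|exact: q0].
- exact: ip.
- apply: aeW => x n _; have /andP[h1 h2] := qp n x.
  by rewrite /= lee_fin ger0_norm.
move=> _ _; rewrite integral0 => /fine_cvgP[_ /cvgrPdist_lt/(_ _ e0)].
move=> [n _ /(_ n (leqnn n))] /=; rewrite sub0r normrN => h; exists n.
exact: le_lt_trans (ler_norm _) h.
Qed.

Lemma cmeasurable_indic (D : set R) : measurable D ->
  cmeasurable (fun x => (\1_D x : R)%:C).
Proof. by move=> mD; apply: cmeasurable_real; exact: measurable_indic. Qed.

Lemma measurable_norm_gt1 : measurable [set t : R | 1 < `|t|].
Proof.
rewrite (_ : mkset _ = ~` `[-1, 1]%classic); first by apply: measurableC.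
apply/seteqP; split=> t; rewrite /= in_itv/= -ler_norml.
  by rewrite ltNge => /negP.
by move/negP; rewrite -ltNge.
Qed.

Lemma cmeasurable_invsqr : cmeasurable (fun t : R => (t ^- 2)%:C).
Proof.
apply: cmeasurable_real; rewrite (_ : (fun _ => _) = (fun t => (t ^+ 2) `^ (-1))).
  by apply: (measurableT_comp (@measurable_powR R (-1))); exact: measurable_funX.
by apply/funext => t; rewrite powR_inv1 ?sqr_ge0.
Qed.

Lemma normc_indic (D : set R) x : normc (\1_D x : R)%:C <= 1.
Proof. by rewrite normc_real indicE; case: (x \in D); rewrite ?normr0 ?normr1. Qed.

Lemma L1_bounded (g f : R -> R[i]) (B : R) : cmeasurable g ->
  (forall x, normc (g x) <= B) -> L1 f -> L1 (fun x => g x * f x).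
Proof.
move=> mg gB f1; apply: (@L1_le _ _ (fun x => B * normc (f x))).
- exact: cmeasurableM (L1_cmeasurable f1).
- exact/integrable_rl/L1_normc.
- by move=> x; rewrite normcM ler_wpM2r ?normc_ge0.
Qed.

Lemma L1_indic (D : set R) f : measurable D -> L1 f ->
  L1 (fun x => (\1_D x)%:C * f x).
Proof.
move=> mD; apply: (@L1_bounded _ _ 1); first exact: cmeasurable_indic.
exact: normc_indic.
Qed.

End dominated.

Section primitive.
Context {R : realType}.
Local Notation mu := (@lebesgue_measure R).
Local Notation Re := (@complex.Re R).
Local Notation Im := (@complex.Im R).
Local Notation cint := (cintegral [set: R]).
Implicit Types (f : R -> R[i]) (p : R -> R).

Definition cprimitive f (y : R) := cintegral `]-oo, y]%classic f.

Lemma primitive_is_derive p (x : R) : mu.-integrable setT (EFin \o p) ->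
  continuous p ->
  is_derive x 1 (fun y => \int[mu]_(s in `]-oo, y]%classic) p s) (p x).
Proof.
move=> ip cp.
have [||||d1 d2] := @continuous_FTC1 _ p -oo%O x (x + 1).
- by rewrite ltrDl.
- exact: integrableS ip.
- by rewrite ltNyr.
- exact: cp.
- by apply: DeriveDef => //; rewrite -derive1E.
Qed.

Lemma cprimitive_is_cderive f : L1 f -> ccontinuous f ->
  forall x, is_cderive (cprimitive f) x (f x).
Proof.
by move=> [f1 f2] [c1 c2] x; split; exact: primitive_is_derive.
Qed.

(** The increments are dominated by those of twice the primitive of [normc (f s)], the 2 being that
    of [normc_cintegral_le]. *)
Lemma cprimitive_bv f : L1 f -> bv (cprimitive f).
Proof.
move=> f1; have mi (y : R) : measurable (`]-oo, y]%classic : set R) by [].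
pose q y s := \1_(`]-oo, y]%classic) s * normc (f s).
have iq y : mu.-integrable setT (EFin \o q y).
  apply: le_integrable (L1_normc f1) => //.
    apply/measurable_EFinP; apply: measurable_funM.
      exact: measurable_indic.
    by apply: cmeasurable_normc; exact: L1_cmeasurable.
  move=> s _; rewrite /= lee_fin normrM ler_piMl//.
  by have := normc_indic `]-oo, y] s; rewrite normc_real.
apply: (@dominated_bv _ (fun y => 2 * \int[mu]_s q y s) (2 * \int[mu]_s normc (f s))).
  move=> y; rewrite mulr_ge0 ?Rintegral_ge0//=; last first.
    by move=> s _; rewrite mulr_ge0 ?normc_ge0.
  rewrite ler_wpM2l// le_Rintegral//; first exact: L1_normc.
  by move=> s _; rewrite ler_piMl ?normc_ge0.
move=> x y xy; rewrite -mulrBr -RintegralB//.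
rewrite /cprimitive !(cintegral_mkcond `]-oo, _]).
rewrite -cintegralB; [|exact: L1_indic|exact: L1_indic].
apply: normc_cintegral_le.
- by apply: L1_cmeasurable; apply: L1B; exact: L1_indic.
- rewrite (_ : _ \o _ = (EFin \o q y) \- (EFin \o q x))%E; last by [].
  exact: integrableB.
- move=> s; rewrite -!mulrBl normcM ler_wpM2r ?normc_ge0//.
  rewrite -rmorphB normc_real ger0_norm// subr_ge0 !indicE.
  rewrite ler_nat; case: (boolP (s \in _)) => //.
  rewrite inE/= in_itv/= => sx; rewrite mem_set//=.
  by rewrite in_itv/= (le_trans sx).
Qed.

(** One point beyond each [A] suffices, because increments elsewhere are controlled by the
    variation; so dominated convergence along [A + n] is enough. *)
Lemma cprimitive_near_top f (A e : R) : L1 f -> 0 < e ->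
  exists2 b, A <= b & normc (cprimitive f b - cint f) < e.
Proof.
move=> f1 e0; have e2 : 0 < e / 2 by rewrite divr_gt0.
pose q (n : nat) s := `|\1_(`]-oo, (A + n%:R)]%classic) s - 1| * normc (f s).
have mq n : measurable_fun setT (q n).
  apply: measurable_funM; last first.
    by apply: cmeasurable_normc; exact: L1_cmeasurable.
  by apply: measurableT_comp => //; exact: measurable_funB.
have i1 n s : `|\1_(`]-oo, (A + n%:R)]%classic) s - 1| <= 1 :> R.
  by rewrite indicE; case: (s \in _); rewrite ?subrr ?sub0r ?normr0 ?normrN ?normr1.
have [||n qn] := @dominated_convergence0 R q _ (e / 2) mq (L1_normc f1) _ _ e2.
- by move=> n s; rewrite mulr_ge0 ?normc_ge0//= ler_piMl ?normc_ge0.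
- move=> s; apply: cvg_near_cst; near=> n.
  rewrite /q indicE mem_set ?subrr ?normr0 ?mul0r//= in_itv/= -lerBlDl.
  by near: n; exact: nbhs_infty_ger.
exists (A + n%:R); first by rewrite lerDl.
rewrite /cprimitive cintegral_mkcond -cintegralB//; last exact: L1_indic.
rewrite (le_lt_trans (normc_cintegral_le (p := q n) _ _ _))//.
- by apply: L1_cmeasurable; apply: L1B => //; exact: L1_indic.
- apply: le_integrable (L1_normc f1) => //; first by apply/measurable_EFinP; exact: mq.
  by move=> s _; rewrite /= lee_fin normrM normr_id ler_piMl.
- move=> s; rewrite -[X in _ - X]mul1r -mulrBl normcM.
  by rewrite -(rmorph1 (real_complex R)) -rmorphB normc_real.
- by rewrite mulrC -ltr_pdivlMr.
Unshelve. all: by end_near. Qed.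

Lemma cprimitive_near_bot f (A e : R) : L1 f -> 0 < e ->
  exists2 a, a <= A & normc (cprimitive f a) < e.
Proof.
move=> f1 e0; have e2 : 0 < e / 2 by rewrite divr_gt0.
pose q (n : nat) s := \1_(`]-oo, (A - n%:R)]%classic) s * normc (f s).
have mq n : measurable_fun setT (q n).
  apply: measurable_funM; last first.
    by apply: cmeasurable_normc; exact: L1_cmeasurable.
  exact: measurable_indic.
have i1 n s : \1_(`]-oo, (A - n%:R)]%classic) s <= 1 :> R.
  by rewrite indicE; case: (s \in _); rewrite ?ler01.
have [||n qn] := @dominated_convergence0 R q _ (e / 2) mq (L1_normc f1) _ _ e2.
- by move=> n s; rewrite mulr_ge0 ?normc_ge0//= ler_piMl ?normc_ge0.
- move=> s; apply: cvg_near_cst; near=> n.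
  rewrite /q indicE memNset ?mul0r//= in_itv/=; apply/negP.
  rewrite -ltNge ltrBlDl -ltrBlDr.
  by near: n; exact: nbhs_infty_gtr.
exists (A - n%:R); first by rewrite gerBl.
rewrite /cprimitive cintegral_mkcond.
rewrite (le_lt_trans (normc_cintegral_le (p := q n) _ _ _))//.
- by apply: L1_cmeasurable; exact: L1_indic.
- apply: le_integrable (L1_normc f1) => //; first by apply/measurable_EFinP; exact: mq.
  by move=> s _; rewrite /= lee_fin normrM ler_piMl// ger0_norm.
- by move=> s; rewrite normcM normc_real ger0_norm.
- by rewrite mulrC -ltr_pdivlMr.
Unshelve. all: by end_near. Qed.

End primitive.

(** * The Stieltjes integral of exp(-ist) *)

Section stieltjes_primitive.
Context {R : realType}.
Local Notation mu := (@lebesgue_measure R).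
Local Notation cint := (cintegral [set: R]).
Variables (u v : R -> R[i]) (N : R -> R) (V : R).
Hypothesis uv : forall x, is_cderive u x (v x).
Hypothesis u1 : L1 u.
Hypothesis NV : brange N V.
Hypothesis Nv : dominates_increments N v.
Hypothesis u0 : vanishes_at_infinity u.
Hypothesis v0 : vanishes_at_infinity v.
Implicit Types (t x y : R).

Let NI : {homo N : x y / x <= y}.
Proof. exact: dominates_homo Nv. Qed.

Let wave t s : R[i] := expNi (s * t) * u s.

Let wave_continuous t : ccontinuous (wave t).
Proof.
apply: (is_cderive_continuous (g := fun s => _)) => s.
by apply: is_cderiveM (uv s); exact: is_cderive_expNi.
Qed.

Let wave1 t : L1 (wave t).
Proof.
apply: (L1_bounded (B := 1)) u1; last by move=> s; rewrite normc_expNi.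
under eq_fun do rewrite mulrC.
exact: cmeasurable_section cmeasurable2_expNi.
Qed.

(* [y |-> stieltjes_wave t y] is a primitive of [expNi (y * t) dv(y)], obtained
   by integrating by parts twice; this needs no second derivative of [u]. *)
Definition stieltjes_wave t y : R[i] :=
  expNi (y * t) * v y + (0 +i* t) * expNi (y * t) * u y
  - (t ^+ 2)%:C * cprimitive (fun s => expNi (s * t) * u s) y.

Lemma normc_dexpNi t x y : x <= y ->
  normc (expNi (y * t) - expNi (x * t)) <= 2 * `|t| * (y - x).
Proof.
move=> xy; apply: (@cMVT_bound _ (fun s => expNi (s * t)) _ _ _ _ xy) => z.
  exact: is_cderive_expNi.
by rewrite normcM normc_expNi mulr1 normc_i normrN.
Qed.

(** Freezing [v] at [x] in the first term of [stieltjes_wave] gives a function [H] that is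
    differentiable even where [v] is not. In its derivative the terms in [t ^+ 2] cancel and only
    [v z - v x] survives, which is small. This accounts for half of the factor 4; moving the phase
    from [y] to [xi] accounts for the other half. *)
Lemma stieltjes_wave_local t x xi y : x <= xi <= y ->
  normc (expNi (xi * t) * (v y - v x)
         - (stieltjes_wave t y - stieltjes_wave t x))
    <= 4 * `|t| * (y - x) * (N y - N x).
Proof.
move=> /andP[xxi xiy]; have xy := le_trans xxi xiy.
have W0 : 0 <= N y - N x by rewrite subr_ge0 NI.
pose H z : R[i] := expNi (z * t) * v x + (0 +i* t) * (expNi (z * t) * u z)
  - (t ^+ 2)%:C * cprimitive (wave t) z.
pose h z : R[i] := (0 +i* t) * expNi (z * t) * (v z - v x).
have dH z : is_cderive H z (h z).
  have dp := is_cderiveZ (- (t ^+ 2)%:C) (cprimitive_is_cderive (wave1 t) (wave_continuous t) z).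
  have de := is_cderive_expNi t z.
  have d1 := is_cderiveM de (is_cderive_cst (v x) z).
  have d2 := is_cderiveZ (0 +i* t) (is_cderiveM de (uv z)).
  have := is_cderiveD (is_cderiveD d1 d2) dp.
  rewrite (_ : (fun _ => _) = H); last first.
    by apply/funext => s; rewrite /H mulNr.
  rewrite (_ : _ + _ = h z)//.
  (* All coefficients are written through [0 +i* t], whose square is opaque to [ring]. *)
  have -> : (t ^+ 2)%:C = - ((0 +i* t) * (0 +i* t)) :> R[i].
    by apply: eq_ReIm; rewrite !cReImE /=; ring.
  have -> : 0 -i* t = - (0 +i* t) :> R[i].
    by apply: eq_ReIm; rewrite !cReImE /=; ring.
  by rewrite /h /wave; ring.
have hW z : x <= z <= y -> normc (h z) <= `|t| * (N y - N x).
  move=> /andP[xz zy]; rewrite !normcM normc_expNi mulr1 normc_i.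
  by rewrite ler_wpM2l// (le_trans (Nv xz))// lerD2r NI.
have HH := cMVT_bound xy dH hW.
have -> : expNi (xi * t) * (v y - v x) - (stieltjes_wave t y - stieltjes_wave t x)
   = - ((H y - H x) + (expNi (y * t) - expNi (xi * t)) * (v y - v x)).
  by rewrite /H /stieltjes_wave /wave; ring.
rewrite normcN (le_trans (le_normcD _ _))// normcM.
have h1 : normc (expNi (y * t) - expNi (xi * t)) <= 2 * `|t| * (y - x).
  rewrite (le_trans (normc_dexpNi _ xiy))// ler_wpM2l ?mulr_ge0//.
  by rewrite lerD2l lerN2.
have h2 : normc (expNi (y * t) - expNi (xi * t)) * normc (v y - v x) <=
    (2 * `|t| * (y - x)) * (N y - N x).
  by rewrite ler_pM ?normc_ge0// Nv.
by lra.
Qed.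

Lemma stieltjes_wave_mesh t (a b delta : R) s xi : itv_partition a b s ->
  (forall i, (i < size s)%N -> node a b s i.+1 - node a b s i < delta /\
     node a b s i <= xi i <= node a b s i.+1) ->
  normc (\sum_(0 <= i < size s)
      expNi (xi i * t) * (v (node a b s i.+1) - v (node a b s i))
    - (stieltjes_wave t b - stieltjes_wave t a)) <=
  4 * `|t| * delta * (N b - N a).
Proof.
move=> ab hxi.
have -> : stieltjes_wave t b - stieltjes_wave t a = \sum_(0 <= i < size s)
    (stieltjes_wave t (node a b s i.+1) - stieltjes_wave t (node a b s i)).
  by rewrite (telescope_sumr (fun i => stieltjes_wave t (node a b s i)))// node_size.
rewrite -(telescope_partition N ab).
rewrite -sumrB mulr_sumr (le_trans (normc_sum _ _))// !big_nat.
apply: ler_sum => i /andP[_ iS]; have [d1 d2] := hxi i iS.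
have /andP[d3 d4] := d2; have d5 := le_trans d3 d4.
rewrite (le_trans (stieltjes_wave_local t d2))// ler_wpM2r ?subr_ge0 ?NI//.
by rewrite ler_wpM2l ?mulr_ge0// ltW.
Qed.

Lemma stieltjes_wave_sum (a b t : R) s xi : itv_partition a b s ->
  normc (\sum_(0 <= i < size s)
      expNi (xi i * t) * (v (node a b s i.+1) - v (node a b s i))) <= N b - N a.
Proof.
move=> ab; rewrite -(telescope_partition N ab) (le_trans (normc_sum _ _))// !big_nat.
apply: ler_sum => i /andP[_ iS]; rewrite normcM normc_expNi mul1r.
by rewrite Nv// ltW// node_lt.
Qed.

(** The explicit formula would give a bound depending on [t]. Instead the increment is a limit of
    sums of exponentials as the mesh tends to 0, and each of these is bounded by the variation of
    [v] uniformly in [t]. *)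
Lemma stieltjes_wave_increment t x y : x <= y ->
  normc (stieltjes_wave t y - stieltjes_wave t x) <= N y - N x.
Proof.
rewrite le_eqVlt => /predU1P[->|xy]; first by rewrite !subrr Normc.normc0.
have W0 : 0 <= N y - N x by rewrite subr_ge0 NI// ltW.
apply/ler_addgt0Pr => e e0.
pose C := 4 * `|t| * (N y - N x).
have C0 : 0 <= C by rewrite !mulr_ge0.
have d0 : 0 < e / (C + 1) by rewrite divr_gt0// ltr_wpDl.
have [s ab hs] := ex_fine_partition xy d0.
have h : forall i, (i < size s)%N ->
   node x y s i.+1 - node x y s i < e / (C + 1) /\
   node x y s i <= node x y s i <= node x y s i.+1.
  by move=> i /hs[? ->]; rewrite lexx.
have h1 := stieltjes_wave_mesh t ab h.
have h2 := stieltjes_wave_sum t (node x y s) ab.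
have h3 : 4 * `|t| * (e / (C + 1)) * (N y - N x) <= e.
  rewrite (_ : _ * _ = C * (e / (C + 1))); last by rewrite /C; ring.
  rewrite mulrA ler_pdivrMr ?ltr_wpDl//; nra.
move: h1 h2; set S := \sum_(_ <= _ < _) _ => h1 h2.
rewrite normc_distC in h1.
rewrite -[X in normc X](subrK S) (le_trans (le_normcD _ _))//.
by rewrite addrC lerD// (le_trans h1).
Qed.

(** The boundary terms disappear with [v] and [u], and the primitive tends to the full integral;
    each of the three terms gets a share [e / 3]. *)
Lemma stieltjes_wave_near_top t (A e : R) : 0 < e -> exists2 b, A <= b &
  normc (stieltjes_wave t b + (t ^+ 2)%:C * cint (wave t)) < e.
Proof.
move=> e0; have e3 : 0 < e / 3 by rewrite divr_gt0.
have e3t : 0 < e / 3 / (`|t| + 1) by rewrite divr_gt0// ltr_wpDl.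
have e3t2 : 0 < e / 3 / (t ^+ 2 + 1) by rewrite divr_gt0// ltr_wpDl// sqr_ge0.
have [B vB] := v0 e3; have [C uC] := u0 e3t.
have [b Mb pb] := cprimitive_near_top (`|A| + `|B| + `|C|) (wave1 t) e3t2.
have nB := ler_norm B; have nC := ler_norm C; have nA := ler_norm A.
have := normr_ge0 A; have := normr_ge0 B; have := normr_ge0 C => C0 B0 A0.
exists b; first lra.
have b0 : 0 <= b by lra.
have h1 : normc (v b) < e / 3 by apply: vB; rewrite ger0_norm//; lra.
have h2 : normc (u b) < e / 3 / (`|t| + 1) by apply: uC; rewrite ger0_norm//; lra.
rewrite (_ : _ + _ = expNi (b * t) * v b + ((0 +i* t) * expNi (b * t) * u b
   + - (t ^+ 2)%:C * (cprimitive (wave t) b - cint (wave t)))); last first.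
  by rewrite /stieltjes_wave /wave; ring.
rewrite (le_lt_trans (le_normcD _ _))//.
rewrite (le_lt_trans (lerD (lexx _) (le_normcD _ _)))//.
rewrite !normcM normc_expNi mul1r mulr1 normc_i normcN normc_real.
rewrite [`|t ^+ 2|]ger0_norm ?sqr_ge0//.
have h3 : `|t| * normc (u b) <= e / 3.
  move: h2; rewrite ltr_pdivlMr ?ltr_wpDl//.
  by have := normr_ge0 t; have := normc_ge0 (u b); nra.
have h4 : t ^+ 2 * normc (cprimitive (wave t) b - cint (wave t)) <= e / 3.
  move: pb; rewrite ltr_pdivlMr ?ltr_wpDl ?sqr_ge0//.
  by have := sqr_ge0 t; have := normc_ge0 (cprimitive (wave t) b - cint (wave t)); nra.
by lra.
Qed.

Lemma stieltjes_wave_near_bot t (A e : R) : 0 < e -> exists2 a, a <= A &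
  normc (stieltjes_wave t a) < e.
Proof.
move=> e0; have e3 : 0 < e / 3 by rewrite divr_gt0.
have e3t : 0 < e / 3 / (`|t| + 1) by rewrite divr_gt0// ltr_wpDl.
have e3t2 : 0 < e / 3 / (t ^+ 2 + 1) by rewrite divr_gt0// ltr_wpDl// sqr_ge0.
have [B vB] := v0 e3; have [C uC] := u0 e3t.
have [b Mb pb] := cprimitive_near_bot (- (`|A| + `|B| + `|C|)) (wave1 t) e3t2.
have nB := ler_norm B; have nC := ler_norm C.
have nA : - A <= `|A| by rewrite -normrN ler_norm.
have := normr_ge0 A; have := normr_ge0 B; have := normr_ge0 C => C0 B0 A0.
exists b; first lra.
have b0 : b <= 0 by lra.
have h1 : normc (v b) < e / 3 by apply: vB; rewrite ler0_norm//; lra.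
have h2 : normc (u b) < e / 3 / (`|t| + 1) by apply: uC; rewrite ler0_norm//; lra.
rewrite (_ : stieltjes_wave t b = expNi (b * t) * v b + ((0 +i* t) * expNi (b * t) * u b
   + - (t ^+ 2)%:C * cprimitive (wave t) b)); last first.
  by rewrite /stieltjes_wave /wave; ring.
rewrite (le_lt_trans (le_normcD _ _))//.
rewrite (le_lt_trans (lerD (lexx _) (le_normcD _ _)))//.
rewrite !normcM normc_expNi mul1r mulr1 normc_i normcN normc_real.
rewrite [`|t ^+ 2|]ger0_norm ?sqr_ge0//.
have h3 : `|t| * normc (u b) <= e / 3.
  move: h2; rewrite ltr_pdivlMr ?ltr_wpDl//.
  by have := normr_ge0 t; have := normc_ge0 (u b); nra.
have h4 : t ^+ 2 * normc (cprimitive (wave t) b) <= e / 3.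
  move: pb; rewrite ltr_pdivlMr ?ltr_wpDl ?sqr_ge0//.
  by have := sqr_ge0 t; have := normc_ge0 (cprimitive (wave t) b); nra.
by lra.
Qed.

Lemma fourierE t : fourier u t = cint (wave t).
Proof. by congr cintegral; apply/funext => s; rewrite /wave mulrC (mulrC t) mulrC. Qed.

(** The integral of the exponential against [dv] over the whole line is [- t ^+ 2 * fourier u t].
    The four errors [e] are the distances to the limits at the auxiliary points [a'] and [b'] and
    the increments on [[a', a]] and [[b, b']]. The bound is uniform in [t], although [a'] and [b']
    depend on [t]. *)
Lemma stieltjes_wave_tail t (a b A e : R) : 0 < e ->
  (forall x y, x <= y -> A <= x \/ y <= - A -> N y - N x < e) ->
  a <= - A -> A <= b ->
  normc (stieltjes_wave t b - stieltjes_wave t a + (t ^+ 2)%:C * fourier u t)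
    <= 4 * e.
Proof.
move=> e0 NA aA Ab; rewrite fourierE.
have [b' bb' h1] := stieltjes_wave_near_top t b e0.
have [a' aa' h2] := stieltjes_wave_near_bot t a e0.
have h3 := stieltjes_wave_increment t bb'.
have h4 := stieltjes_wave_increment t aa'.
have h5 := NA _ _ bb' (or_introl Ab).
have h6 := NA _ _ aa' (or_intror aA).
rewrite (_ : _ + _ = (stieltjes_wave t b' + (t ^+ 2)%:C * cint (wave t)) +
  - ((stieltjes_wave t b' - stieltjes_wave t b) +
   ((stieltjes_wave t a - stieltjes_wave t a') + stieltjes_wave t a'))); last ring.
rewrite (le_trans (le_normcD _ _))// normcN.
have := le_normcD (stieltjes_wave t b' - stieltjes_wave t b)
   ((stieltjes_wave t a - stieltjes_wave t a') + stieltjes_wave t a').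
have := le_normcD (stieltjes_wave t a - stieltjes_wave t a') (stieltjes_wave t a').
by lra.
Qed.

(** By [stieltjes_wave_tail] with [e = 1], [t ^+ 2 * fourier u t] differs by at most 4 in modulus
    from minus an increment of [stieltjes_wave], itself at most [V]; the constant 8 leaves room. The
    integral term bounds [fourier u t] itself. *)
Lemma fourier_decay t :
  normc (fourier u t) <= (2 * \int[mu]_x normc (u x) + V + 8) / (1 + t ^+ 2).
Proof.
have V0 : 0 <= V by have /andP[h1 h2] := NV 0; exact: le_trans h2.
have h1 : normc (fourier u t) <= 2 * \int[mu]_x normc (u x).
  rewrite fourierE; apply: normc_cintegral_le.
  - exact: L1_cmeasurable.
  - exact: L1_normc.
  - by move=> x; rewrite normcM normc_expNi mul1r.
have h2 : t ^+ 2 * normc (fourier u t) <= V + 8.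
  clear h1.
  have [A A0 NA] := brange_tail NV NI (ltr01 : 0 < 1 :> R).
  have := @stieltjes_wave_tail t (- A) A A 1 ltr01 NA (lexx _) (lexx _).
  have AA : - A <= A by lra.
  have := stieltjes_wave_increment t AA.
  have /andP[? ?] := NV A; have /andP[? ?] := NV (- A).
  set X := stieltjes_wave t A - _ => i1 i2.
  rewrite -[t ^+ 2]ger0_norm ?sqr_ge0// -normc_real -normcM.
  rewrite (_ : _ * _ = (X + (t ^+ 2)%:C * fourier u t) - X); last ring.
  by rewrite (le_trans (le_normcD _ _))// normcN (le_trans (lerD i2 i1))//; lra.
rewrite ler_pdivlMr ?ltr_wpDr ?sqr_ge0//.
by rewrite mulrDr mulr1 -addrA lerD// mulrC.
Qed.

Lemma cmeasurable_fourier : cmeasurable (fourier u).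
Proof.
apply: cmeasurable_param; apply: cmeasurable2M; first exact: cmeasurable2_expNi.
exact/cmeasurable2_snd/L1_cmeasurable.
Qed.

Lemma L1_fourier : L1 (fourier u).
Proof.
apply: (L1_le _ (integrable_rl (2 * \int[mu]_x normc (u x) + V + 8) integrable_oneDsqrV)).
  exact: cmeasurable_fourier.
exact: fourier_decay.
Qed.

Lemma cmeasurable_stieltjes_wave y : cmeasurable (stieltjes_wave^~ y).
Proof.
have me : cmeasurable (fun t => expNi (y * t)).
  exact: cmeasurable_section cmeasurable2_expNi.
have mt : cmeasurable (fun t : R => 0 +i* t) by split; [exact: measurable_cst|exact: measurable_id].
apply: cmeasurableD.
  apply: cmeasurableD; first by apply: cmeasurableM => //; exact: cmeasurable_cst.
  apply: cmeasurableM; last exact: cmeasurable_cst.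
  exact: cmeasurableM.
under eq_fun do rewrite -mulNr -rmorphN.
apply: cmeasurableM.
  by apply: cmeasurable_real; apply: measurable_funN; exact: measurable_funX.
under eq_fun do rewrite /cprimitive cintegral_mkcond.
apply: cmeasurable_param; apply: cmeasurable2M.
  by apply: cmeasurable2_snd; exact: cmeasurable_indic.
apply: cmeasurable2M; last exact/cmeasurable2_snd/L1_cmeasurable.
exact: cmeasurable2_swap cmeasurable2_expNi.
Qed.

End stieltjes_primitive.

(** * Parseval's formula for the distributional integral *)

Section parseval.
Context {R : realType}.
Local Notation mu := (@lebesgue_measure R).
Local Notation cint := (cintegral [set: R]).
Variables (u v F : R -> R[i]) (M : R).
Hypothesis uv : forall x, is_cderive u x (v x).
Hypothesis u1 : L1 u.
Hypothesis bvv : bv v.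
Hypothesis u0 : vanishes_at_infinity u.
Hypothesis v0 : vanishes_at_infinity v.
Hypothesis mF : cmeasurable F.
Hypothesis FM : forall t, normc (F t) <= M.
Implicit Types (t x y : R).

Let M0 : 0 <= M. Proof. exact: le_trans (normc_ge0 _) (FM 0). Qed.

Let D : set R := [set t | 1 < `|t|].

Let mD : measurable D. Proof. exact: measurable_norm_gt1. Qed.

Let G t : R[i] := (\1_D t)%:C * (F t * (t ^- 2)%:C).

Let mG : cmeasurable G.
Proof.
apply: cmeasurableM; first exact: cmeasurable_indic.
by apply: cmeasurableM => //; exact: cmeasurable_invsqr.
Qed.

Let G_bound t : normc (G t) <= 2 * M * (1 + t ^+ 2)^-1.
Proof.
have t0 := sqr_ge0 t.
rewrite /G indicE; case: (boolP (t \in D)) => [|_]; last first.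
  by rewrite mul0r Normc.normc0 !mulr_ge0// invr_ge0 addr_ge0.
rewrite inE/D/= => t1; rewrite mul1r normcM normc_real ger0_norm ?invr_ge0//.
have t2 : 1 <= t ^+ 2 by rewrite -(real_normK (num_real t)) exprn_ege1// ltW.
have t3 : (t ^+ 2)^-1 <= 2 * (1 + t ^+ 2)^-1.
  rewrite -[X in X <= _]mul1r ler_pdivrMr; last lra.
  rewrite mulrAC ler_pdivlMr; lra.
by rewrite (mulrC 2) -mulrA ler_pM ?normc_ge0 ?invr_ge0.
Qed.

Let G1 : L1 G.
Proof. exact: L1_le mG (integrable_rl _ integrable_oneDsqrV) G_bound. Qed.

Let PsiE s : Psi F s = cint (fun t => expNi (s * t) * G t).
Proof.
rewrite /Psi (cintegral_mkcond D); congr cintegral; apply/funext => t.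
by rewrite /G; ring.
Qed.

Let GE f : cmeasurable f -> (exists B, forall t, normc (f t) <= B) ->
  L1 (fun t => f t * G t).
Proof. by move=> mf [B fB]; exact: L1_bounded fB G1. Qed.

Let J a b := cint (fun t => (stieltjes_wave u v t b - stieltjes_wave u v t a) * G t).

Let me s : cmeasurable (fun t => expNi (s * t) : R[i]).
Proof. exact: cmeasurable_section cmeasurable2_expNi. Qed.

(** [J a b] is the double integral with the [dv] integral evaluated inside. A Riemann-Stieltjes sum
    of [Psi F] is exactly the integral of [S t * G t], so it remains to let [S] converge under the
    integral sign. *)
Lemma is_stieltjes_itv_Psi a b : a <= b -> is_stieltjes_itv (Psi F) v a b (J a b).
Proof.
move=> ab e e0; have [N [V [NV Nv]]] := bv_dominated bvv.
have NI := dominates_homo Nv.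
pose W := N b - N a; have W0 : 0 <= W by rewrite subr_ge0 NI.
have mwave (y : R) := cmeasurable_stieltjes_wave v u1 y.
have winc t := stieltjes_wave_increment uv u1 Nv t ab.
(* The first 2 is that of [normc_cintegral_le]; [2] and [4] come from the variation bound and the
   mesh bound, and [W + 1] keeps [C] positive. *)
pose C := 2 * (2 + 4) * (W + 1).
have C0 : 0 < C by rewrite /C; lra.
(* The minimum merges the constant error bound with the one proportional to [t] times the mesh
   [n.+1%:R^-1]; thus [q n] tends to 0 pointwise below the integrable [normc (G t)]. *)
pose q (n : nat) t := normc (G t) * Num.min 1 (`|t| / n.+1%:R).
have mq n : measurable_fun setT (q n).
  apply: measurable_funM; first exact: cmeasurable_normc.
  apply: measurable_minr => //; apply: measurable_funM => //.
have q01 n t : 0 <= Num.min 1 (`|t| / n.+1%:R) <= (1 : R).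
  by rewrite le_min ler01/= divr_ge0//= ge_min lexx.
have qG n t : 0 <= q n t <= normc (G t).
  have /andP[? ?] := q01 n t.
  by rewrite mulr_ge0 ?normc_ge0//= ler_piMr ?normc_ge0.
have [||n qn] := @dominated_convergence0 R q _ (e / C) mq (L1_normc G1) qG.
- move=> t; rewrite -(mulr0 (normc (G t))); apply: cvgMr.
  apply: (@squeeze_cvgr _ _ _ _ (fun=> 0) (fun n => `|t| / n.+1%:R)).
  + apply: nearW => n; have /andP[-> _] := q01 n t.
    by rewrite ge_min lexx orbT.
  + exact: cvg_cst.
  + rewrite -(mulr0 `|t|); apply: cvgMr; exact: cvg_harmonic.
- by rewrite divr_gt0.
exists n.+1%:R^-1 => // s xi sab hxi.
pose S t := \sum_(0 <= i < size s)
   expNi (xi i * t) * (v (node a b s i.+1) - v (node a b s i)).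
have mS : cmeasurable S.
  rewrite /S; elim: (index_iota 0 (size s)) => [|i r ih].
    by under eq_fun do rewrite big_nil; exact: cmeasurable_cst.
  under eq_fun do rewrite big_cons; apply: cmeasurableD => //.
  by apply: cmeasurableM => //; exact: cmeasurable_cst.
have SW t : normc (S t) <= W := stieltjes_wave_sum Nv t xi sab.
have SE : \sum_(0 <= i < size s) Psi F (xi i) *
    (v (node a b s i.+1) - v (node a b s i)) = cint (fun t => S t * G t).
  transitivity (cint (fun t => \sum_(0 <= i < size s)
    (v (node a b s i.+1) - v (node a b s i)) * (expNi (xi i * t) * G t))).
    rewrite cintegral_sum; last first.
      by move=> i; apply: L1Zl; apply: GE => //; exists 1 => t; rewrite normc_expNi.
    apply: eq_bigr => i _; rewrite cintegralZl ?PsiE 1?mulrC//.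
    by apply: GE => //; exists 1 => t; rewrite normc_expNi.
  congr cintegral; apply/funext => t; rewrite /S mulr_suml.
  by apply: eq_bigr => i _; ring.
have iq : mu.-integrable setT (EFin \o q n).
  apply: le_integrable (L1_normc G1) => //; first by apply/measurable_EFinP; exact: mq.
  by move=> t _; have /andP[h1 h2] := qG n t; rewrite /= lee_fin !ger0_norm ?normc_ge0.
rewrite SE /J -cintegralB; last 2 first.
- by apply: GE => //; exists W.
- by apply: GE; [exact: (cmeasurableD _ (cmeasurableN _))|exists W].
apply: le_lt_trans (normc_cintegral_le (p := fun t => (2 + 4) * (W + 1) * q n t) _ _ _) _.
- apply: cmeasurableD; [exact: cmeasurableM|apply: cmeasurableN].
  by apply: cmeasurableM => //; apply: cmeasurableD => //; exact: cmeasurableN.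
- exact: integrable_rl.
- move=> t; rewrite -mulrBl normcM /q mulrCA mulrC ler_wpM2l ?normc_ge0//.
  have h1 := stieltjes_wave_mesh uv u1 Nv t sab hxi.
  have h2 : normc (S t - (stieltjes_wave u v t b - stieltjes_wave u v t a)) <= 2 * W.
    rewrite (le_trans (le_normcD _ _))// normcN mulr_natl mulr2n lerD//.
  rewrite /Num.min; case: ifP => _.
    by rewrite mulr1 (le_trans h2)//; lra.
  rewrite (le_trans h1)// -/W -(mulrA 4) [X in X <= _]mulrAC.
  by rewrite ler_wpM2r ?divr_ge0//; lra.
- rewrite RintegralZl// mulrA (mulrA 2) -/C mulrC -ltr_pdivlMr//.
Qed.

Let J_limit : R[i] := cint (fun t => - ((t ^+ 2)%:C * fourier u t) * G t).

(** Since [stieltjes_wave_tail] is uniform in [t], integrability of [G] suffices to let the interval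
    grow. In [e / (8 * (I + 1))] the 8 absorbs its factor 4 and the 2 of [normc_cintegral_le]. *)
Lemma is_stieltjes_Psi : is_stieltjes (Psi F) v J_limit.
Proof.
move=> e e0; have [N [V [NV Nv]]] := bv_dominated bvv.
pose I := \int[mu]_t normc (G t).
have I0 : 0 <= I by apply: Rintegral_ge0 => t _; exact: normc_ge0.
have d0 : 0 < e / (8 * (I + 1)) by rewrite divr_gt0// mulr_gt0// ltr_wpDl.
have [A A0 NA] := brange_tail NV (dominates_homo Nv) d0.
exists A => // a b aA Ab; have ab : a <= b by lra.
exists (J a b); first exact: is_stieltjes_itv_Psi.
have mwave (y : R) := cmeasurable_stieltjes_wave v u1 y.
have mW : cmeasurable (fun t => stieltjes_wave u v t b - stieltjes_wave u v t a).
  by apply: cmeasurableD => //; exact: cmeasurableN.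
have mT : cmeasurable (fun t => - ((t ^+ 2)%:C * fourier u t)).
  apply: cmeasurableN; apply: cmeasurableM; last exact: cmeasurable_fourier.
  by apply: cmeasurable_real; exact: measurable_funX.
have bT t : normc (- ((t ^+ 2)%:C * fourier u t)) <=
    2 * \int[mu]_x normc (u x) + V + 8.
  have t0 := sqr_ge0 t.
  rewrite normcN normcM normc_real ger0_norm//.
  have := fourier_decay uv u1 NV Nv u0 v0 t; set B := (X in X / _) => h.
  have B0 : 0 <= B.
    rewrite -(@pmulr_lge0 _ (1 + t ^+ 2)^-1) ?invr_gt0 ?ltr_wpDr//.
    exact: le_trans (normc_ge0 _) h.
  rewrite (le_trans (ler_wpM2l t0 h))// mulrA ler_pdivrMr ?ltr_wpDr//.
  by rewrite mulrC [leRHS]mulrDr mulr1 lerDr.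
rewrite /J /J_limit -cintegralB; last 2 first.
- apply: GE => //; exists (N b - N a) => t.
  exact: (stieltjes_wave_increment uv u1 Nv t ab).
- by apply: GE => //; eexists; exact: bT.
apply: le_lt_trans (normc_cintegral_le (p := fun t => 4 * (e / (8 * (I + 1))) * normc (G t)) _ _ _) _.
- by apply: cmeasurableD; [|apply: cmeasurableN]; exact: cmeasurableM.
- exact/integrable_rl/L1_normc.
- move=> t; rewrite -mulrBl normcM ler_wpM2r ?normc_ge0// opprK.
  exact: (stieltjes_wave_tail uv u1 Nv u0 v0 t d0 NA).
- rewrite RintegralZl//; last exact: L1_normc.
  rewrite -/I (_ : 2 * _ = e * (I / (I + 1))); last by field; lra.
  by rewrite gtr_pMr// ltr_pdivrMr ?ltr_wpDl//; lra.
Qed.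

Let fourier1_pairing :
  cint (fun s => fourier1 F s * u s) =
  cint (fun t => (\1_(`[-1, 1]%classic) t)%:C * (F t * fourier u t)).
Proof.
pose E t : R[i] := (\1_(`[-1, 1]%classic) t)%:C * F t.
have mE : cmeasurable E by apply: cmeasurableM => //; exact: cmeasurable_indic.
have E1 : L1 E.
  apply: (L1_le mE (integrable_rl (2 * M) integrable_oneDsqrV)) => t.
  have t0 := sqr_ge0 t.
  rewrite normcM indicE; case: (boolP (t \in _)) => [|_]; last first.
    by rewrite Normc.normc0 mul0r !mulr_ge0// invr_ge0 addr_ge0.
  move=> tI; have t1 : `|t| <= 1 by move: tI; rewrite inE/= in_itv/= -ler_norml.
  rewrite Normc.normc1 mul1r.
  have t2 : t ^+ 2 <= 1 by rewrite -(real_normK (num_real t)) exprn_ile1.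
  by rewrite (le_trans (FM t))// ler_pdivlMr ?ltr_wpDr//; rewrite mulrC ler_wpM2r//; lra.
pose k s t : R[i] := u s * (expNi (s * t) * E t).
have mk : cmeasurable2 k.
  apply: cmeasurable2M; first exact/cmeasurable2_fst/L1_cmeasurable.
  by apply: cmeasurable2M; [exact: cmeasurable2_expNi|exact: cmeasurable2_snd].
have b1 s : L1 (fun t => expNi (s * t) * E t).
  by apply: (L1_bounded (B := 1)) E1 => // t; rewrite normc_expNi.
have b2 t : L1 (fun s => expNi (s * t) * u s).
  apply: (L1_bounded (B := 1)) u1 => [|s]; last by rewrite normc_expNi.
  by under eq_fun do rewrite mulrC.
transitivity (cint (fun s => cint (k s))).
  congr cintegral; apply/funext => s; rewrite /k cintegralZl// mulrC; congr (_ * _).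
  rewrite /fourier1 cintegral_mkcond; congr cintegral; apply/funext => t.
  by rewrite /E; ring.
have kE t : k^~ t = fun s => E t * (expNi (s * t) * u s).
  by apply/funext => s; rewrite /k; ring.
rewrite (cfubini (p := fun s => normc (u s) * \int[mu]_t normc (E t)) mk).
- congr cintegral; apply/funext => t.
  rewrite kE cintegralZl// mulrA; congr (_ * _); congr cintegral.
  by apply/funext => s; rewrite (mulrC t).
- under eq_fun do rewrite mulrC.
  exact/integrable_rl/L1_normc.
- by move=> s; exact: L1Zl.
- by move=> t; rewrite kE; exact: L1Zl.
- move=> s; rewrite -RintegralZl//; last exact: L1_normc.
  by rewrite le_eqVlt; apply/orP; left; apply/eqP; apply: eq_Rintegral => t _;
    rewrite /k !normcM normc_expNi mul1r.
Qed.

Lemma is_dist_integral_fourier : abs_continuous u -> ccontinuous v ->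
  is_dist_integral F u (cint (fun t => F t * fourier u t)).
Proof.
move=> acu cv; split => //; first by split => //; exists M; exact: aeW.
exists v, J_limit; split.
- split => //; last by apply: aeW.
  move=> x; have [c1 c2] := cv; split; apply: cvg_at_right_filter.
    exact: c1.
  exact: c2.
- exact: is_stieltjes_Psi.
have [N [V [NV Nv]]] := bv_dominated bvv.
have f1 := L1_fourier uv u1 NV Nv u0 v0.
have Ff1 : L1 (fun t => F t * fourier u t) by exact: L1_bounded f1.
(* On [D] the factor [t ^+ 2] of the double integration by parts cancels the weight [t ^- 2] of
   [Psi]; this leaves the part of the pairing that [[-1, 1]] misses. *)
have JE t : - ((t ^+ 2)%:C * fourier u t) * G t = - ((\1_D t)%:C * (F t * fourier u t)).
  rewrite /G indicE; case: (boolP (t \in D)) => [|_]; last by rewrite !mul0r mulr0 oppr0.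
  rewrite inE/D/= => t1.
  have t0 : (t ^+ 2)%:C * (t ^- 2)%:C = 1 :> R[i].
    rewrite -rmorphM divff ?rmorph1// sqrf_eq0.
    by apply: contraTneq t1 => ->; rewrite normr0 ltr10.
  rewrite (_ : _ * _ = - (1%:C * (F t * fourier u t)) * ((t ^+ 2)%:C * (t ^- 2)%:C)); last ring.
  by rewrite t0 mulr1.
rewrite fourier1_pairing /J_limit; under [X in _ - X]eq_cintegral do rewrite JE.
rewrite -cintegralB; last 2 first.
- exact: L1_indic.
- by under eq_fun do rewrite -mulN1r; apply: L1Zl; exact: L1_indic.
congr cintegral; apply/funext => t; rewrite opprK -mulrDl -rmorphD.
rewrite (_ : \1__ t + \1_D t = 1) ?rmorph1 ?mul1r// !indicE.
have -> : (t \in D) = (t \notin `[-1, 1]%classic).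
  apply/idP/idP; rewrite !inE /D/=.
    by move=> t1; rewrite notin_setE/= in_itv/= -ler_norml; apply/negP; rewrite -ltNge.
  by rewrite notin_setE/= in_itv/= -ler_norml => /negP; rewrite -ltNge.
by case: (t \in _) => /=; rewrite ?addr0 ?add0r.
Qed.
End parseval.

(** * Regularity of Fourier transforms *)

Section regularity.
Context {R : realType}.
Local Notation mu := (@lebesgue_measure R).
Local Notation Re := (@complex.Re R).
Local Notation Im := (@complex.Im R).
Local Notation cint := (cintegral [set: R]).
Implicit Types (f g h : R -> R[i]) (s t x y : R).

Lemma ccontinuousD f g : ccontinuous f -> ccontinuous g ->
  ccontinuous (fun x => f x + g x).
Proof.
move=> [f1 f2] [g1 g2]; split=> x.
- by under eq_fun do rewrite cReD; apply: (@cvgD _ R); [exact: f1|exact: g1].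
- by under eq_fun do rewrite cImD; apply: (@cvgD _ R); [exact: f2|exact: g2].
Qed.

Lemma ccontinuousM f g : ccontinuous f -> ccontinuous g ->
  ccontinuous (fun x => f x * g x).
Proof.
move=> [f1 f2] [g1 g2]; split=> x.
- under eq_fun do rewrite cReM.
  by apply: (@cvgB _ R); apply: cvgM; [exact: f1|exact: g1|exact: f2|exact: g2].
- under eq_fun do rewrite cImM.
  by apply: (@cvgD _ R); apply: cvgM; [exact: f1|exact: g2|exact: f2|exact: g1].
Qed.

Lemma lipschitz_abs_continuous f (L : R) :
  (forall x y, x <= y -> normc (f y - f x) <= L * (y - x)) -> abs_continuous f.
Proof.
move=> fL a b ab e e0.
have L0 : 0 < `|L| + 1 by rewrite ltr_wpDl.
exists (e / (`|L| + 1)); first by rewrite divr_gt0.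
move=> n x y xy _; rewrite ltr_pdivlMr// => h; apply: le_lt_trans h.
rewrite mulr_suml !big_nat; apply: ler_sum => i /andP[_ /xy[/andP[_ xyi] _]].
rewrite (le_trans (fL _ _ xyi))// mulrC ler_wpM2l ?subr_ge0//.
by rewrite (le_trans (ler_norm L))// lerDl.
Qed.

Lemma abs_continuous_ccontinuous f : abs_continuous f -> ccontinuous f.
Proof.
move=> fac.
have key x e : 0 < e -> \forall y \near x, normc (f y - f x) < e.
  move=> e0; have [|d d0 h] := fac (x - 1) (x + 1) _ _ e0; first lra.
  apply/nbhs_ballP; exists (Num.min d 1); first by rewrite /= lt_min d0 ltr01.
  have one a b : x - 1 <= a -> a <= b -> b <= x + 1 -> b - a < d ->
      normc (f b - f a) < e.
    move=> xa ab bx abd.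
    have := h 1%N (fun=> a) (fun=> b); rewrite !big_nat1; apply => //.
    - by move=> i _; rewrite xa ab bx.
    - by move=> i j /=; rewrite !ltnS !leqn0 => /eqP -> /eqP ->.
  move=> y /=; rewrite /ball/= lt_min => /andP[xyd xy1].
  have [yx|xy] := leP y x.
    by rewrite normc_distC; apply: one => //; move: xyd xy1; rewrite ger0_norm ?subr_ge0//; lra.
  by apply: one; move: xyd xy1; rewrite ltr0_norm ?subr_lt0//; lra.
split=> x; apply/cvgrPdist_lt => e e0.
- near=> y; rewrite distrC -cReB (le_lt_trans (le_Re_normc _))//; near: y.
  exact: key.
- near=> y; rewrite distrC -cImB (le_lt_trans (le_Im_normc _))//; near: y.
  exact: key.
Unshelve. all: by end_near. Qed.

(** The second moment dominates [g] outside [[-1, 1]] but says nothing near 0, where continuity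
    gives a bound; the factor 2 compensates [1 + x ^+ 2 <= 2] there. *)
Lemma L1_of_second_moment g : ccontinuous g ->
  L1 (fun x => (x ^+ 2)%:C * g x) -> L1 g.
Proof.
move=> cg g2; have [c1 c2] := cg.
have evt (p : R -> R) : continuous p -> exists B, forall x, -1 <= x <= 1 -> `|p x| <= B.
  move=> cp; have [||c _ hc] := @EVT_max R (fun x => `|p x|) (-1) 1.
  - lra.
  - by apply: continuous_subspaceT => x; apply: cvg_norm; exact: cp.
  - by exists `|p c| => x x1; apply: hc; rewrite in_itv.
have [B1 h1] := evt _ c1; have [B2 h2] := evt _ c2.
have ip := integrableD measurableT
  (integrable_rl (2 * (`|B1| + `|B2|)) integrable_oneDsqrV) (L1_normc g2).
apply: (L1_le (ccontinuous_measurable cg) ip) => x /=.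
have x0 := sqr_ge0 x; have B0 : 0 <= `|B1| + `|B2| by rewrite addr_ge0.
have [x1|x1] := leP `|x| 1.
  rewrite ler_wpDr ?normc_ge0//.
  have x2 : x ^+ 2 <= 1 by rewrite -(real_normK (num_real x)) exprn_ile1.
  apply: (@le_trans _ _ (`|B1| + `|B2|)).
    rewrite (le_trans (normc_le_ReIm _))// lerD//.
      by rewrite (le_trans (h1 _ _)) ?ler_norm// -ler_norml.
    by rewrite (le_trans (h2 _ _)) ?ler_norm// -ler_norml.
  by rewrite ler_pdivlMr ?ltr_wpDr//; nra.
rewrite ler_wpDl//; first by rewrite divr_ge0 ?mulr_ge0// addr_ge0.
rewrite normcM normc_real ger0_norm// ler_peMl ?normc_ge0//.
by rewrite -(real_normK (num_real x)) exprn_ege1// ltW.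
Qed.

Lemma L1_first_moment g : L1 g -> L1 (fun x => (x ^+ 2)%:C * g x) ->
  L1 (fun x => x%:C * g x).
Proof.
move=> g1 g2; have ip := integrableD measurableT (L1_normc g1) (L1_normc g2).
apply: (L1_le _ ip) => [|x /=].
  apply: cmeasurableM; last exact: L1_cmeasurable.
  by apply: cmeasurable_real.
rewrite !normcM !normc_real normrX -[X in X + _]mul1r -mulrDl.
rewrite ler_wpM2r ?normc_ge0//.
by have := normr_ge0 x; nra.
Qed.

Lemma fourier_bound g s : L1 g -> normc (fourier g s) <= 2 * \int[mu]_t normc (g t).
Proof.
move=> g1; apply: normc_cintegral_le.
- apply: cmeasurableM; last exact: L1_cmeasurable.
  exact: cmeasurable_section cmeasurable2_expNi.
- exact: L1_normc.
- by move=> t; rewrite normcM normc_expNi mul1r.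
Qed.

(** Differentiation under the integral sign: the phase has modulus 1, so [normc (t%:C * g t)]
    dominates the derivative at every frequency. *)
Lemma is_cderive_fourier g s : L1 g -> L1 (fun t => t%:C * g t) ->
  is_cderive (fourier g) s (fourier (fun t => (0 -i* t) * g t) s).
Proof.
move=> g1 g2.
have wave1 x : L1 (fun t => expNi (x * t) * g t).
  apply: (L1_bounded (B := 1)) g1 => [|t]; last by rewrite normc_expNi.
  exact: cmeasurable_section cmeasurable2_expNi.
have dw x t : is_cderive (fun z => expNi (z * t) * g t) x
    ((0 -i* t) * expNi (x * t) * g t).
  have := is_cderiveM (is_cderive_expNi t x) (is_cderive_cst (g t) x).
  by rewrite mulr0 addr0.
have key (P : R[i] -> R) : (forall z, `|P z| <= normc z) ->
    (forall x, mu.-integrable setT (EFin \o (fun t => P (expNi (x * t) * g t)))) ->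
    (forall x t, is_derive x 1 (fun z => P (expNi (z * t) * g t))
      (P ((0 -i* t) * expNi (x * t) * g t))) ->
    is_derive s 1 (fun x => \int[mu]_t P (expNi (x * t) * g t))
      (\int[mu]_t P (expNi (s * t) * ((0 -i* t) * g t))).
  move=> Pn iP dP.
  pose f x t := P (expNi (x * t) * g t).
  have sI : `]s - 1, s + 1[%classic s by rewrite /= in_itv/= ltrBlDr ltrDl ltr01.
  have df x t : `]s - 1, s + 1[%classic x -> setT t -> derivable (f^~ t) x 1.
    by move=> _ _; case: (dP x t).
  have d1 x t : derive1 (f^~ t) x = P ((0 -i* t) * expNi (x * t) * g t).
    by rewrite derive1E; case: (dP x t).
  have bd x t : `]s - 1, s + 1[%classic x -> setT t ->
      `|derive1 (f^~ t) x| <= normc (t%:C * g t).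
    move=> _ _; rewrite d1 (le_trans (Pn _))// !normcM normc_i normrN.
    by rewrite normc_expNi mulr1 normc_real.
  have G0 t : 0 <= normc (t%:C * g t) by exact: normc_ge0.
  apply: DeriveDef.
    exact: (derivable_under_integral measurableT sI (fun x _ => iP x) df G0 (L1_normc g2) bd).
  rewrite -derive1E (differentiation_under_integral measurableT sI (fun x _ => iP x) df G0 (L1_normc g2) bd).
  apply: eq_Rintegral => t _; apply: etrans (d1 s t) _; congr P; ring.
split.
- apply: key.
  + exact: le_Re_normc.
  + by move=> x; have [] := wave1 x.
  + by move=> x t; have [] := dw x t.
- apply: key.
  + exact: le_Im_normc.
  + by move=> x; have [] := wave1 x.
  + by move=> x t; have [] := dw x t.
Qed.

End regularity.

(** * The convolution theorem *)

Section product_with_transform.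
Context {R : realType}.
Local Notation mu := (@lebesgue_measure R).
Local Notation cint := (cintegral [set: R]).
Implicit Types (f g h G k : R -> R[i]).

Lemma bounded_derivative_lipschitz G k (B : R) :
  (forall x, is_cderive G x (k x)) -> (forall x, normc (k x) <= B) ->
  forall x y, x <= y -> normc (G y - G x) <= 2 * B * (y - x).
Proof. by move=> Gk kB x y xy; apply: (cMVT_bound xy Gk). Qed.

(** A function [v] of bounded variation is bounded, so [u] is Lipschitz and therefore absolutely
    continuous. *)
Lemma dist_integral_parseval (F u v : R -> R[i]) (M : R) :
  cmeasurable F -> (forall t, normc (F t) <= M) ->
  (forall x, is_cderive u x (v x)) -> L1 u -> ccontinuous v -> bv v ->
  vanishes_at_infinity u -> vanishes_at_infinity v ->
  is_dist_integral F u (cint (fun t => F t * fourier u t)).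
Proof.
move=> mF FM uv u1 cv bvv u0 v0.
have [B vB] := bv_bounded bvv.
apply: (is_dist_integral_fourier uv u1 bvv u0 v0 mF FM) cv.
exact: lipschitz_abs_continuous (bounded_derivative_lipschitz uv vB).
Qed.

Variables (g h : R -> R[i]).
Hypothesis g1 : L1 g.
Hypothesis g2 : L1 (fun x => (x ^+ 2)%:C * g x).
Hypothesis h1 : L1 h.
Hypothesis hC1 : C1 h.
Hypothesis bvh : bv h.
Hypothesis bvdh : bv (cderive h).

Let dh : forall x, is_cderive h x (cderive h x). Proof. by case: hC1. Qed.
Let ch : ccontinuous h. Proof. exact: is_cderive_continuous dh. Qed.
Let cdh : ccontinuous (cderive h). Proof. by case: hC1. Qed.

(** [h] is the derivative of its own primitive, which is of bounded variation because [h] is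
    integrable. *)
Let h0 : vanishes_at_infinity h.
Proof.
exact: bv_derivative_vanishes (cprimitive_is_cderive h1 ch) bvh (cprimitive_bv h1).
Qed.

Let dh0 : vanishes_at_infinity (cderive h).
Proof. exact: bv_derivative_vanishes dh bvdh bvh. Qed.

Let xg (t : R) : R[i] := (0 -i* t) * g t.

Let xgE t : xg t = (0 -i* 1) * (t%:C * g t).
Proof.
rewrite /xg mulrA; congr (_ * _).
by apply: eq_ReIm; rewrite !cReImE /=; ring.
Qed.

Let xg1 : L1 xg.
Proof.
rewrite (_ : xg = fun t => (0 -i* 1) * (t%:C * g t)); last exact/funext.
exact/L1Zl/L1_first_moment.
Qed.

Let xxg1 : L1 (fun t => t%:C * xg t).
Proof.
have E t : t%:C * xg t = (0 -i* 1) * ((t ^+ 2)%:C * g t).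
  by rewrite xgE rmorphXn/=; ring.
by under eq_fun do rewrite E; exact: L1Zl.
Qed.

Let dgh s : is_cderive (fourier g) s (fourier xg s).
Proof. by apply: is_cderive_fourier => //; exact: L1_first_moment. Qed.

(** Here the second moment of [g] enters: it bounds the derivative of [fourier xg], which makes
    [fourier xg] Lipschitz as [bvMl] requires. *)
Let ddgh s := is_cderive_fourier s xg1 xxg1.

Let xxxg1 : L1 (fun t => (0 -i* t) * xg t).
Proof.
have E t : (0 -i* t) * xg t = (0 -i* 1) * (t%:C * xg t).
  by rewrite mulrA; congr (_ * _); apply: eq_ReIm; rewrite !cReImE /=; ring.
by under eq_fun do rewrite E; exact: L1Zl.
Qed.

Let u s := fourier g s * h s.
Let v s := fourier xg s * h s + fourier g s * cderive h s.

Let cg : ccontinuous (fourier g). Proof. exact: is_cderive_continuous dgh. Qed.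
Let cxg : ccontinuous (fourier xg). Proof. exact: is_cderive_continuous ddgh. Qed.

Let uv x : is_cderive u x (v x).
Proof. exact: is_cderiveM. Qed.

Let L1u : L1 u.
Proof.
apply: (L1_bounded _ (fun s => fourier_bound s g1)) => //.
exact: ccontinuous_measurable.
Qed.

(** The two summands of [v] are of bounded variation by [bvMl], applied to [h] with its primitive
    and to [cderive h] with [h]. *)
Lemma is_dist_integral_fourier_mul f (M : R) :
  cmeasurable f -> (forall t, normc (f t) <= M) ->
  is_dist_integral f (fun s => fourier g s * h s)
    (cint (fun t => f t * fourier (fun s => fourier g s * h s) t)).
Proof.
move=> mf fM; apply: (dist_integral_parseval (v := v) mf fM) => //.
- by apply: ccontinuousD; exact: ccontinuousM.
- apply: bvD.
    apply: (bvMl (fun s => fourier_bound s xg1)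
      (bounded_derivative_lipschitz ddgh (fun s => fourier_bound s xxxg1))
      (cprimitive_is_cderive h1 ch)) => //.
    exact: cprimitive_bv.
  exact: (bvMl (fun s => fourier_bound s g1)
    (bounded_derivative_lipschitz dgh (fun s => fourier_bound s xg1)) dh).
- exact: vanishesMl (fun s => fourier_bound s g1) h0.
- apply: vanishesD; first exact: vanishesMl (fun s => fourier_bound s xg1) h0.
  exact: vanishesMl (fun s => fourier_bound s g1) dh0.
Qed.

Lemma is_dist_integral_C1 F (M : R) :
  cmeasurable F -> (forall t, normc (F t) <= M) ->
  is_dist_integral F h (cint (fun t => F t * fourier h t)).
Proof. by move=> mF FM; exact: (dist_integral_parseval (v := cderive h) mF FM). Qed.

(** Fubini, dominated by [normc (g y) * normc (h s)]; the two phases merge into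
    [expNi ((t + y) * s)]. *)
Lemma fourier_mul t : fourier (fun s => fourier g s * h s) t =
  cint (fun y => g y * fourier h (t + y)).
Proof.
pose k s y : R[i] := (expNi (t * s) * h s) * (expNi (s * y) * g y).
have mE x : cmeasurable (fun s : R => expNi (x * s) : R[i]).
  exact: cmeasurable_section cmeasurable2_expNi.
have w1 x f : L1 f -> L1 (fun s => expNi (x * s) * f s).
  by apply: (L1_bounded (B := 1)) => // s; rewrite normc_expNi.
have kE y : k^~ y = fun s => g y * (expNi ((t + y) * s) * h s).
  apply/funext => s; rewrite /k mulrDl expNiD (mulrC s); ring.
have mk : cmeasurable2 k.
  apply: cmeasurable2M; first exact/cmeasurable2_fst/L1_cmeasurable/w1.
  apply: cmeasurable2M; first exact: cmeasurable2_expNi.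
  exact/cmeasurable2_snd/L1_cmeasurable.
transitivity (cint (fun s => cint (k s))).
  congr cintegral; apply/funext => s; rewrite cintegralZl; last exact: w1.
  by rewrite -/(fourier g s); ring.
rewrite (cfubini (p := fun s => (\int[mu]_y normc (g y)) * normc (h s)) mk).
- congr cintegral; apply/funext => y; rewrite kE cintegralZl//; exact: w1.
- exact/integrable_rl/L1_normc.
- by move=> s; apply: L1Zl; exact: w1.
- by move=> y; rewrite kE; apply: L1Zl; exact: w1.
- move=> s; rewrite mulrC -RintegralZl//; last exact: L1_normc.
  by rewrite le_eqVlt; apply/orP; left; apply/eqP; apply: eq_Rintegral => y _;
    rewrite /k !normcM !normc_expNi !mul1r.
Qed.

Variables (f : R -> R[i]) (M : R).
Hypothesis mf : cmeasurable f.
Hypothesis fM : forall t, normc (f t) <= M.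

Let fg1 x : L1 (fun s => f s * g (x - s)).
Proof. exact: (L1_bounded mf fM (L1_reflect x g1)). Qed.

Lemma convolution_bounded x :
  normc (convolution f g x) <= 2 * (M * \int[mu]_s normc (g s)).
Proof.
have i1 := L1_normc g1.
rewrite -(Rintegral_reflect x i1) -RintegralZl//; last exact: integrable_reflect i1.
apply: normc_cintegral_le.
- exact: L1_cmeasurable.
- by apply: integrable_rl; exact: integrable_reflect i1.
- by move=> s; rewrite normcM ler_wpM2r ?normc_ge0.
Qed.

Lemma cmeasurable_convolution : cmeasurable (convolution f g).
Proof.
apply: cmeasurable_param; apply: cmeasurable2M; first exact: cmeasurable2_snd.
exact/cmeasurable2_sub/L1_cmeasurable.
Qed.

(** The inner integrals are at most a constant times [normc (fourier h x)], so Fubini rests on the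
    integrability of [fourier h]. *)
Lemma convolution_fourier :
  cint (fun x => convolution f g x * fourier h x) =
  cint (fun t => f t * fourier (fun s => fourier g s * h s) t).
Proof.
have hh1 : L1 (fourier h).
  have [N [V [NV Nv]]] := bv_dominated bvdh.
  exact: (L1_fourier dh h1 NV Nv h0 dh0).
have hb t := fourier_bound t h1.
have mh := L1_cmeasurable hh1.
pose k x t : R[i] := fourier h x * (f t * g (x - t)).
have gs t : L1 (fun x => g (x - t)).
  have E : (fun x => g (x - t)) = (fun x => (fun s => g (0 - s)) (t - x)).
    by apply/funext => x /=; congr g; ring.
  by rewrite E; exact: L1_reflect (L1_reflect 0 g1).
have kE t : k^~ t = fun x => f t * (fourier h x * g (x - t)).
  by apply/funext => x; rewrite /k; ring.
have k1 t : L1 (fun x => fourier h x * g (x - t)) by exact: L1_bounded hb (gs t).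
have mk : cmeasurable2 k.
  apply: cmeasurable2M; first exact: cmeasurable2_fst.
  apply: cmeasurable2M; first exact: cmeasurable2_snd.
  exact/cmeasurable2_sub/L1_cmeasurable.
have i1 := L1_normc g1.
transitivity (cint (fun x => cint (k x))).
  by congr cintegral; apply/funext => x; rewrite cintegralZl// mulrC.
rewrite (cfubini (p := fun x => M * (\int[mu]_s normc (g s)) * normc (fourier h x)) mk).
- congr cintegral; apply/funext => t; rewrite kE cintegralZl// fourier_mul.
  congr (_ * _).
  (* The substitution [x = t + y] matches the inner integral with [fourier_mul]. *)
  rewrite -(cintegral_shift t (f := fun y => g y * fourier h (t + y))).
    by congr cintegral; apply/funext => x; rewrite subrKC mulrC.
  have -> : (fun y => g y * fourier h (t + y)) = fun y => fourier h (t + y) * g y.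
    by apply/funext => y; rewrite mulrC.
  apply: (L1_bounded _ (fun y => hb (t + y)) g1).
  case: mh => m1 m2; split.
    by apply: (measurableT_comp m1); exact: measurable_funD.
  by apply: (measurableT_comp m2); exact: measurable_funD.
- exact/integrable_rl/L1_normc.
- by move=> x; apply: L1Zl.
- by move=> t; rewrite kE; exact: L1Zl.
- move=> x; rewrite -(Rintegral_reflect x i1) -RintegralZl//; last first.
    exact: integrable_reflect i1.
  rewrite mulrC -RintegralZl//; last by apply: integrable_rl; exact: integrable_reflect i1.
  apply: le_Rintegral => //.
  + exact: L1_normc (L1Zl _ (fg1 x)).
  + by do 2 apply: integrable_rl; exact: integrable_reflect i1.
  + move=> s _; rewrite /k !normcM ler_wpM2l ?normc_ge0//.
    by rewrite ler_wpM2r ?normc_ge0.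
Qed.

End product_with_transform.

(** * From essentially bounded to bounded functions *)

Section reduction_to_bounded.
Context {R : realType}.
Local Notation mu := (@lebesgue_measure R).
Implicit Types (f g u : R -> R[i]).

(** The estimates above use a bound valid at every point, so [f] is set to 0 where it exceeds [M].
    The absolute value covers a negative [M]. *)
Lemma Linfty_bounded_representative f : Linfty f -> exists f' (M : R),
  [/\ cmeasurable f', (forall t, normc (f' t) <= M) & {ae mu, forall x, f x = f' x}].
Proof.
move=> [mf [M fM]]; pose D := [set x | normc (f x) <= M].
have mD : measurable D.
  rewrite (_ : D = (fun x => normc (f x)) @^-1` `]-oo, M]%classic); last first.
    by apply/seteqP; split=> x /=; rewrite in_itv.
  rewrite -[X in measurable X]setTI; exact: cmeasurable_normc.
have FF : Filter (almost_everywhere mu) by exact: ae_filter_ringOfSetsType.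
exists (fun x => (\1_D x)%:C * f x), `|M|; split.
- by apply: cmeasurableM => //; exact: cmeasurable_indic.
- move=> x; rewrite normcM indicE; case: (boolP (x \in D)) => [|_].
    rewrite inE => xM; rewrite Normc.normc1 mul1r (le_trans xM)//; exact: ler_norm.
  by rewrite Normc.normc0 mul0r.
- by apply: filterS fM => x xM; rewrite indicE mem_set// mul1r.
Qed.

Variables f f' : R -> R[i].
Hypothesis mf : cmeasurable f.
Hypothesis mf' : cmeasurable f'.
Hypothesis ff' : {ae mu, forall x, f x = f' x}.

Let ae_eq_cintegral_mul (D : set R) (k : R -> R[i] -> R[i]) : measurable D ->
  cmeasurable (fun x => k x (f x)) -> cmeasurable (fun x => k x (f' x)) ->
  cintegral D (fun x => k x (f x)) = cintegral D (fun x => k x (f' x)).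
Proof.
move=> mD kf kf'; apply: ae_eq_cintegral => //.
have FF : Filter (almost_everywhere mu) by exact: ae_filter_ringOfSetsType.
by apply: filterS ff' => x ->.
Qed.

Lemma ae_eq_convolution g : cmeasurable g -> convolution f g = convolution f' g.
Proof.
move=> mg; apply/funext => x.
apply: (@ae_eq_cintegral_mul _ (fun s z => z * g (x - s))) => //;
  apply: cmeasurableM => //; exact: (cmeasurable_section (k := fun x y => g (x - y))) (cmeasurable2_sub mg).
Qed.

Let me s : cmeasurable (fun t : R => expNi (s * t) : R[i]).
Proof. exact: cmeasurable_section cmeasurable2_expNi. Qed.

Lemma ae_eq_fourier1 : fourier1 f = fourier1 f'.
Proof.
apply/funext => s.
by apply: (@ae_eq_cintegral_mul _ (fun t z => expNi (s * t) * z)) => //;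
  exact: cmeasurableM.
Qed.

Lemma ae_eq_Psi : Psi f = Psi f'.
Proof.
apply/funext => s.
have mt := @cmeasurable_invsqr R; have mD := @measurable_norm_gt1 R.
apply: (@ae_eq_cintegral_mul _ (fun t z => expNi (s * t) * z * (t ^- 2)%:C)) => //;
  by apply: cmeasurableM => //; exact: cmeasurableM.
Qed.

(** Apart from membership in [Linfty], the function enters only through [fourier1] and [Psi],
    integrals that ignore null sets. *)
Lemma ae_eq_is_dist_integral u I : Linfty f ->
  is_dist_integral f' u I -> is_dist_integral f u I.
Proof. by move=> lf [_ acu u1]; rewrite -ae_eq_fourier1 -ae_eq_Psi. Qed.

End reduction_to_bounded.

Local Close Scope classical_set_scope.

Theorem theorem7p1 (R : realType) (f g h : R -> R[i])
    (f_Linfty : Linfty f)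
    (g_ac : abs_continuous g)
    (dg_L1 : L1 (cderive g))
    (dg_bv : exists v : R -> R[i], bv_derivative g v)
    (p2g_L1 : L1 (fun x => (x ^+ 2)%:C * g x))
    (h_L1 : L1 h)
    (h_C1 : C1 h)
    (h_bv : bv h)
    (dh_bv : bv (cderive h))
    (dh_ac : abs_continuous (cderive h)) :
  [/\ dist_integrable (convolution f g) h,
      dist_integrable f (fun s => fourier g s * h s) &
      dist_integral (convolution f g) h =
      dist_integral f (fun s => fourier g s * h s)].
Proof.
have g1 := L1_of_second_moment (abs_continuous_ccontinuous g_ac) p2g_L1.
have [f' [M [mf' f'M ff']]] := Linfty_bounded_representative f_Linfty.
have [mf _] := f_Linfty.
have convE := ae_eq_convolution mf mf' ff' (L1_cmeasurable g1).
have I1 := is_dist_integral_C1 h_L1 h_C1 h_bv dh_bv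
  (cmeasurable_convolution g1 mf') (convolution_bounded g1 mf' f'M).
have I2 := ae_eq_is_dist_integral mf mf' ff' f_Linfty
  (is_dist_integral_fourier_mul g1 p2g_L1 h_L1 h_C1 h_bv dh_bv mf' f'M).
(* The two convolutions are equal at every point, not just almost everywhere, so the result for [f']
   is literally one for [f]. *)
rewrite -convE in I1.
split; [by eexists; exact: I1|by eexists; exact: I2|].
rewrite (dist_integralP I1) (dist_integralP I2) convE.
exact: (convolution_fourier g1 h_L1 h_C1 h_bv dh_bv mf' f'M).
Qed.
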